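(* For every fixed integer $p\ge 2$ there are constants $a_p,b_p,C_p>0$ (depending only on $p$) with the following property. Let $N\ge 1$ be an integer and let $L_p>0$, $D_Z>0$. (i) For every deterministic adaptive algorithm making at most $N$ feasible complete scalar $p$-jet queries, there are dimensions $d_x=d_y=2N+2$, Euclidean balls $X\subseteq\mathbb R^{d_x}$ and $Y\subseteq\mathbb R^{d_y}$ with $\operatorname{diam}(X\times Y)=D_Z$, and a globally smooth convex--concave function $\phi$ on $\mathbb R^{d_x}\times\mathbb R^{d_y}$ with $\operatorname{Lip}(D^p\phi)\le L_p$, such that the algorithm's (possibly unqueried) output $\widehat z$ satisfies $$ r_{\mathrm{tan}}^\phi(\widehat z)\ \ge\ a_p\frac{L_pD_Z^p}{(N+1)^{(3p-1)/2}},\qquad \operatorname{Gap}_\phi(\widehat z)\ \ge\ b_p\frac{L_pD_Z^{p+1}}{(N+1)^{(3p-1)/2}}. $$ (ii) For every randomized adaptive algorithm making at most $N$ feasible complete scalar $p$-jet queries, there are dimensions $d_x,d_y\le C_p(N+1)^3\log(N+2)$, a product $X\times Y$ of Euclidean balls $X\subseteq\mathbb R^{d_x}$, $Y\subseteq\mathbb R^{d_y}$ of diameter $D_Z$, and one fixed admissible function $\phi$ (that is, $(X,Y,\phi)\in\mathfrak S_p(L_p,D_Z)$), independent of the realized random seed, such that $$ \Pr\Bigl\{ r_{\mathrm{tan}}^\phi(\widehat z)\ge a_p\frac{L_pD_Z^p}{(N+1)^{(3p-1)/2}}\Bigr\}\ge\frac34, $$ and, for a possibly different fixed instance of the same kind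 (same dimensions and domain, fixed independently of the realized seed), $$ \Pr\Bigl\{ \operatorname{Gap}_\phi(\widehat z)\ge b_p\frac{L_pD_Z^{p+1}}{(N+1)^{(3p-1)/2}}\Bigr\}\ge\frac34. $$ Here probabilities are over the algorithm's internal random seed.
   Context: Let $X\subseteq\mathbb R^{d_x}$, $Y\subseteq\mathbb R^{d_y}$ be nonempty compact convex sets and $Z=X\times Y$. Norms are Euclidean; $\|\cdot\|_{\mathrm{op}}$ is the operator norm of multilinear forms and $\operatorname{Lip}$ the corresponding Lipschitz constant. For a differentiable $\phi$, the saddle operator is $F_\phi(x,y)=(\nabla_x\phi(x,y),-\nabla_y\phi(x,y))$. The normal cone is $N_Z(z)=\{v:\langle v,z'-z\rangle\le 0\ \forall z'\in Z\}$. The tangent residual is $r_{\mathrm{tan}}^\phi(z)=\operatorname{dist}(0,F_\phi(z)+N_Z(z))$, and the saddle gap is $\operatorname{Gap}_\phi(x,y)=\max_{y'\in Y}\phi(x,y')-\min_{x'\in X}\phi(x',y)$. $\mathfrak S_p(L_p,D_Z)$ is the class of triples $(X,Y,\phi)$ with $X,Y$ nonempty compact convex, $\operatorname{diam}(X\times Y)\le D_Z$, $\phi$ defined and $p$ times continuously differentiable on a neighborhood of $X\times Y$, $\phi(\cdot,y)$ convex on $X$ for every $y\in Y$, $\phi(x,\cdot)$ concave on $Y$ for every $x\in X$, and $\|D^p\phi(z)-D^p\phi(z')\|_{\mathrm{op}}\le L_p\|z-z'\|$ for all $z,z'\in Z$. (A saddle point then exists.) The dimensions may depend on the query budget. A complete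 scalar $p$-jet query at $z\in Z$ returns $\mathcal J_p\phi(z)=(\phi(z),D\phi(z),\dots,D^p\phi(z))$. Every query must lie in $Z$. The algorithm knows the public data (including $p,L_p,D_Z$, target accuracy, dimensions, and feasible sets) but not $\phi$. A deterministic $N$-query algorithm chooses each query $z_t\in Z$ as an arbitrary function of the public data and the transcript $(z_1,\mathcal J_p\phi(z_1),\dots,z_{t-1},\mathcal J_p\phi(z_{t-1}))$; after at most $N$ queries it outputs an arbitrary transcript-dependent point $\widehat z\in Z$, which need not have been queried. A randomized $N$-query algorithm is a deterministic one after drawing an independent internal random seed; its policy and output are measurable. Query and output maps are defined on all finite response histories, with feasible queries and the $N$-query cap on every history. *)

(* Defs.v *)
From HB Require Import structures.
From mathcomp Require Export all_boot all_order all_algebra.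
From mathcomp Require Export all_classical all_reals all_analysis.
Export Order.TTheory GRing.Theory Num.Theory.
Export numFieldNormedType.Exports.

Set Implicit Arguments.
Unset Strict Implicit.
Unset Printing Implicit Defensive.

Local Open Scope classical_set_scope.
Local Open Scope ring_scope.

Section Euclidean.
Context {R : realType}.

(* The library norm on 'rV[R]_n is the sup norm; its topology is nevertheless
   the Euclidean one, so only metric notions are redefined here. *)
Definition dotp n (u v : 'rV[R]_n) : R := \sum_i u 0 i * v 0 i.

Definition enorm n (v : 'rV[R]_n) : R := Num.sqrt (dotp v v).

Definition eball n (c : 'rV[R]_n) (r : R) : set 'rV[R]_n :=
  [set x | enorm (x - c) <= r].

Definition is_ball n (A : set 'rV[R]_n) : Prop :=
  exists c r, 0 < r /\ A = eball c r.

Definition diam n (A : set 'rV[R]_n) : \bar R :=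
  ereal_sup [set (enorm (u - v))%:E | u in A & v in A].

Definition normal_cone n (Z : set 'rV[R]_n) (z : 'rV[R]_n) : set 'rV[R]_n :=
  [set v | forall z', Z z' -> dotp v (z' - z) <= 0].

(* Pairs (x, y) are encoded as concatenated row vectors row_mx x y. *)
Definition prodset dx dy (X : set 'rV[R]_dx) (Y : set 'rV[R]_dy) :
    set 'rV[R]_(dx + dy) :=
  [set z | X (lsubmx z) /\ Y (rsubmx z)].

End Euclidean.

Section Derivatives.
Context {R : realType} {n : nat}.
Implicit Types (f : 'rV[R]_n -> R) (U A : set 'rV[R]_n).

(* Dform f [:: v1; ...; vk] z = D^k f(z)[v1, ..., vk], as iterated directional
   derivatives. *)
Definition Dform f (v : seq 'rV[R]_n) : 'rV[R]_n -> R :=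
  foldr (fun u g => 'D_u g) f v.

(* f is k times continuously differentiable on the open set U. *)
Fixpoint Ck (k : nat) U f : Prop :=
  match k with
  | 0 => forall z, U z -> {for z, continuous f}
  | k'.+1 => (forall z, U z -> differentiable f z) /\
             (forall v, Ck k' U ('D_v f))
  end.

Definition smooth f : Prop := forall k, Ck k setT f.

Definition opnorm k (T : k.-tuple 'rV[R]_n -> R) : \bar R :=
  ereal_sup [set `|T v|%:E | v in [set v | forall i, enorm (tnth v i) <= 1]].

(* D^k f is L-Lipschitz on A for the operator norm. *)
Definition lip_D (k : nat) (L : R) A f : Prop :=
  forall z z', A z -> A z' ->
    (opnorm (fun v : k.-tuple 'rV[R]_n => (Dform f v z - Dform f v z')%R)
       <= (L * enorm (z - z'))%:E)%E.

Definition gradient f (z : 'rV[R]_n) : 'rV[R]_n :=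
  \row_i 'D_(delta_mx 0 i) f z.

(* The p-jet (f(z), Df(z), ..., D^p f(z)) is given by the coordinates
   D^k f(z)[e_i1, ..., e_ik], indexed by k <= p and (i1, ..., ik). *)
Definition jet_index (p : nat) : finType := {k : 'I_p.+1 & k.-tuple 'I_n}.

Definition jet_type (p : nat) : Type := {ffun jet_index p -> R}.

Definition jet (p : nat) f (z : 'rV[R]_n) : jet_type p :=
  [ffun a : jet_index p =>
     Dform f [seq delta_mx 0 i | i : 'I_n <- tagged a] z].

End Derivatives.
Arguments jet_index : clear implicits.
Arguments jet_type : clear implicits.

Section Saddle.
Context {R : realType} {dx dy : nat}.
Implicit Types (phi : 'rV[R]_(dx + dy) -> R) (z : 'rV[R]_(dx + dy)).
Implicit Types (X : set 'rV[R]_dx) (Y : set 'rV[R]_dy).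

Definition convex_concave X Y phi : Prop :=
  (forall y, Y y -> convex_function X (fun x => phi (row_mx x y))) /\
  (forall x, X x -> convex_function Y (fun y => - phi (row_mx x y))).

Definition saddle_op phi z : 'rV[R]_(dx + dy) :=
  row_mx (lsubmx (gradient phi z)) (- rsubmx (gradient phi z)).

Definition tan_residual X Y phi z : R :=
  inf [set enorm (saddle_op phi z + v) | v in normal_cone (prodset X Y) z].

Definition gap X Y phi z : R :=
  sup [set phi (row_mx (lsubmx z) y) | y in Y] -
  inf [set phi (row_mx x (rsubmx z)) | x in X].

End Saddle.

Record domain (R : realType) := Domain {
  dimx : nat;
  dimy : nat;
  setx : set 'rV[R]_dimx;
  sety : set 'rV[R]_dimy;
  setx_nonempty : setx !=set0;
  sety_nonempty : sety !=set0;
  setx_compact : compact setx;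
  sety_compact : compact sety;
  setx_convex : convex_set setx;
  sety_convex : convex_set sety }.
Arguments setx {R} d _.
Arguments sety {R} d _.

Definition setz (R : realType) (dom : domain R) :
    set 'rV[R]_(dimx dom + dimy dom) :=
  prodset (setx dom) (sety dom).
Arguments setz {R} dom _.

(* (X, Y, phi) belongs to the class S_p(L, D).  Since phi is a total function,
   only its values near X x Y are constrained. *)
Definition saddle_class (R : realType) (p : nat) (L D : R) (dom : domain R)
    (phi : 'rV[R]_(dimx dom + dimy dom) -> R) : Prop :=
  [/\ (diam (setz dom) <= D%:E)%E,
      exists U, [/\ open U, setz dom `<=` U & Ck p U phi],
      convex_concave (setx dom) (sety dom) phi &
      lip_D p L (setz dom) phi].

Section Algorithms.
Context {R : realType}.

Definition history (p n : nat) : Type := seq ('rV[R]_n * jet_type R n p).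

(* Given the transcript so far, a policy decides whether to stop (and then
   outputs a point) or to make another query. *)
Record policy (p N : nat) (dom : domain R) := Policy {
  stop : history p (dimx dom + dimy dom) -> bool;
  query : history p (dimx dom + dimy dom) -> 'rV[R]_(dimx dom + dimy dom);
  output : history p (dimx dom + dimy dom) -> 'rV[R]_(dimx dom + dimy dom);
  query_feasible : forall h, setz dom (query h);
  output_feasible : forall h, setz dom (output h);
  query_cap : forall h, (N <= size h)%N -> stop h }.

Fixpoint transcript p N dom (A : policy p N dom)
    (phi : 'rV[R]_(dimx dom + dimy dom) -> R) (t : nat) :
    history p (dimx dom + dimy dom) :=
  match t with
  | 0 => [::]
  | t'.+1 => let h := transcript A phi t' in
      if stop A h then h else rcons h (query A h, jet p phi (query A h))
  end.

(* By query_cap the policy has stopped after N steps. *)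
Definition result p N dom (A : policy p N dom)
    (phi : 'rV[R]_(dimx dom + dimy dom) -> R) :
    'rV[R]_(dimx dom + dimy dom) :=
  output A (transcript A phi N).

(* Histories of length k are parametrized by real tuples, which carry the
   product Borel sigma-algebra in the library ('rV[R]_n and {ffun _} do not). *)
Definition history_code (p n k : nat) : Type :=
  k.-tuple (n.-tuple (measurableTypeR R) *
            #|jet_index n p|.-tuple (measurableTypeR R)).

Definition decode p n k (h : history_code p n k) : history p n :=
  [seq (\row_i (tnth e.1 i : R),
        [ffun a : jet_index n p => (tnth e.2 (enum_rank a) : R)])
  | e <- h].

(* Joint measurability in the seed and the history. *)
Definition measurable_policy d (Om : measurableType d) p N dom
    (A : Om -> policy p N dom) : Prop :=
  forall k : nat,
  [/\ measurable_fun [set: Om * history_code p (dimx dom + dimy dom) k]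
        (fun wh => stop (A wh.1) (decode wh.2)),
      forall i,
      measurable_fun [set: Om * history_code p (dimx dom + dimy dom) k]
        (fun wh => query (A wh.1) (decode wh.2) 0 i : measurableTypeR R) &
      forall i,
      measurable_fun [set: Om * history_code p (dimx dom + dimy dom) k]
        (fun wh => output (A wh.1) (decode wh.2) 0 i : measurableTypeR R)].

End Algorithms.

(* (N + 1)^((3p - 1)/2) *)
Definition rate (R : realType) (p N : nat) : R :=
  N.+1%:R `^ ((3 * p%:R - 1) / 2).

(* Main.v *)
Require Import Defs.
From mathcomp Require Import measurable_realfun ring lra zify.

(** Fix hidden orthonormal frames u_0, ..., u_N and w_0, ..., w_N and put
    X_i = <u_i, x>, Y_i = <w_i, y>, X_{-1} = M. The hard function is the chain
      phi = c * sum_i eta ((X_{i-1} - X_i) / delta, Y_i / delta),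
    with a smooth convex-concave coupling eta that agrees with s t up to terms
    of linear growth, has bounded derivatives of every order >= 2, and vanishes
    on [-1, 1]^2. The link i is therefore invisible, together with all its
    derivatives, wherever X_{i-1}, X_i and Y_i are at most delta / 2 in
    absolute value, so one query reveals at most one link. An output with
    |X_N| <= delta / 2 is compared with x' = M sum_i u_i, which kills every
    first argument, and y' = M sum_i w_i, for which the sum telescopes to about
    M^2 / delta^2: this bounds the gap below. Testing F_phi + N_Z against
    (x', y') turns it into a lower bound for the tangent residual.

    Against a deterministic algorithm the frames are chosen orthogonal to the
    queries, one link at a time. Against a randomized one they are chosen
    greedily too: a uniform random-sign combination of a large orthonormal
    family, orthogonal to the previous links, is almost orthogonal to any given
    query by Hoeffding's inequality, and averaging over the seed gives a fixed
    choice that is good with high probability. *)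

Set Implicit Arguments.
Unset Strict Implicit.
Unset Printing Implicit Defensive.

Local Open Scope classical_set_scope.
Local Open Scope ring_scope.

(** * Euclidean geometry of row vectors *)

(** The exponent balances three constraints. The test points are sums of N+1 orthogonal steps of
    length M inside a ball, so M is of order D / sqrt (N+1). Each link loses a term of order M /
    delta against a telescoped gain (M / delta)^2, so delta is of order M / (N+1). The Lipschitz
    bound allows c of order L delta^(p+1), with no power of N: orthonormality absorbs the sum over
    links through Bessel and Cauchy-Schwarz. Then c M^2 / delta^2 has order L M^(p+1) / (N+1)^(p-1),
    which is the stated rate. The coupling must lose s t near the origin yet keep it far away, and
    stay convex-concave. Subtracting theta(s) theta(t), with theta bounded and equal to the identity
    on [-1, 1], does the former; the terms 2 G(s) - 2 G(t), flat on [-1, 1] and of linear growth,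
    restore the curvature. A random unit vector spread over m orthonormal directions has correlation
    of order D / sqrt m with a query. This has to stay below delta, of order D / (N+1)^(3/2), for
    all queries and links at once, whence m of order (N+1)^3 log (N+2). *)

Section EuclideanGeometry.
Context {R : realType}.
Implicit Types n d k : nat.

Lemma dotpC n (u v : 'rV[R]_n) : dotp u v = dotp v u.
Proof. by apply: eq_bigr => i _; rewrite mulrC. Qed.

Lemma dotpDl n (u v w : 'rV[R]_n) : dotp (u + v) w = dotp u w + dotp v w.
Proof. by rewrite -big_split/=; apply: eq_bigr => i _; rewrite mxE mulrDl. Qed.

Lemma dotpZl n a (u w : 'rV[R]_n) : dotp (a *: u) w = a * dotp u w.
Proof. by rewrite mulr_sumr; apply: eq_bigr => i _; rewrite mxE mulrA. Qed.

Lemma dotpDr n (u v w : 'rV[R]_n) : dotp w (u + v) = dotp w u + dotp w v.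
Proof. by rewrite dotpC dotpDl !(dotpC w). Qed.

Lemma dotpZr n a (u w : 'rV[R]_n) : dotp w (a *: u) = a * dotp w u.
Proof. by rewrite dotpC dotpZl (dotpC w). Qed.

Lemma dotpNl n (u w : 'rV[R]_n) : dotp (- u) w = - dotp u w.
Proof. by rewrite -scaleN1r dotpZl mulN1r. Qed.

Lemma dotpNr n (u w : 'rV[R]_n) : dotp w (- u) = - dotp w u.
Proof. by rewrite dotpC dotpNl dotpC. Qed.

Lemma dotpBl n (u v w : 'rV[R]_n) : dotp (u - v) w = dotp u w - dotp v w.
Proof. by rewrite dotpDl dotpNl. Qed.

Lemma dotpBr n (u v w : 'rV[R]_n) : dotp w (u - v) = dotp w u - dotp w v.
Proof. by rewrite dotpDr dotpNr. Qed.

Lemma dotp0l n (w : 'rV[R]_n) : dotp 0 w = 0.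
Proof. by rewrite -(scale0r w) dotpZl mul0r. Qed.

Lemma dotp0r n (w : 'rV[R]_n) : dotp w 0 = 0.
Proof. by rewrite dotpC dotp0l. Qed.

Lemma dotp_suml n (I : Type) (r : seq I) (P : pred I) (F : I -> 'rV[R]_n) w :
  dotp (\sum_(i <- r | P i) F i) w = \sum_(i <- r | P i) dotp (F i) w.
Proof.
by elim/big_rec2: _ => [|i y1 y2 _ <-]; rewrite ?dotp0l// dotpDl.
Qed.

Lemma dotp_sumr n (I : Type) (r : seq I) (P : pred I) (F : I -> 'rV[R]_n) w :
  dotp w (\sum_(i <- r | P i) F i) = \sum_(i <- r | P i) dotp w (F i).
Proof. by rewrite dotpC dotp_suml; apply: eq_bigr => i _; rewrite dotpC. Qed.

Lemma dotp_ge0 n (u : 'rV[R]_n) : 0 <= dotp u u.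
Proof. by apply: sumr_ge0 => i _; rewrite -expr2 sqr_ge0. Qed.

Lemma dotp_eq0 n (u : 'rV[R]_n) : dotp u u = 0 -> u = 0.
Proof.
move=> u0; apply/rowP => i; rewrite mxE; apply/eqP; rewrite -sqrf_eq0 expr2.
move: u0 => /eqP; rewrite psumr_eq0 => [/allP/(_ i)|j _]; last first.
  by rewrite -expr2 sqr_ge0.
by apply; rewrite mem_index_enum.
Qed.

Lemma dotp_delta n (u : 'rV[R]_n) i : dotp u (delta_mx 0 i) = u 0 i.
Proof.
rewrite /dotp (bigD1 i)//= big1 => [|j ji]; first by rewrite !mxE !eqxx mulr1 addr0.
by rewrite !mxE (negPf ji) andbF mulr0.
Qed.

Lemma dotp_row_mx m n (a c : 'rV[R]_m) (b d : 'rV[R]_n) :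
  dotp (row_mx a b) (row_mx c d) = dotp a c + dotp b d.
Proof.
rewrite /dotp big_split_ord/=; congr (_ + _); apply: eq_bigr => i _.
  by rewrite !row_mxEl.
by rewrite !row_mxEr.
Qed.

Lemma enorm_ge0 n (u : 'rV[R]_n) : 0 <= enorm u.
Proof. exact: sqrtr_ge0. Qed.

Lemma enorm_sqr n (u : 'rV[R]_n) : enorm u ^+ 2 = dotp u u.
Proof. by rewrite sqr_sqrtr// dotp_ge0. Qed.

Lemma enorm_le n (u : 'rV[R]_n) r : 0 <= r -> (enorm u <= r) = (dotp u u <= r ^+ 2).
Proof. by move=> r0; rewrite -enorm_sqr ler_sqr// nnegrE enorm_ge0. Qed.

Lemma enormN n (u : 'rV[R]_n) : enorm (- u) = enorm u.
Proof. by rewrite /enorm dotpNl dotpNr opprK. Qed.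

Lemma enorm0 n : enorm (0 : 'rV[R]_n) = 0.
Proof. by rewrite /enorm dotp0l sqrtr0. Qed.

Lemma dotp_sqr_le n (u v : 'rV[R]_n) : dotp u v ^+ 2 <= dotp u u * dotp v v.
Proof.
have [v0|v0] := eqVneq (dotp v v) 0.
  by rewrite (dotp_eq0 v0) !dotp0r mulr0 expr0n.
have vp : 0 < dotp v v by rewrite lt_neqAle eq_sym v0 dotp_ge0.
have := dotp_ge0 (dotp v v *: u - dotp u v *: v).
rewrite !(dotpBl, dotpBr, dotpZl, dotpZr) (dotpC v u) => h.
rewrite -(ler_pM2l vp) -subr_ge0; apply: le_trans h _.
by rewrite le_eqVlt; apply/orP; left; apply/eqP; ring.
Qed.

Lemma dotp_norm_le n (u v : 'rV[R]_n) : `|dotp u v| <= enorm u * enorm v.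
Proof.
rewrite -ler_sqr ?nnegrE// ?mulr_ge0 ?enorm_ge0// -normrX ger0_norm ?sqr_ge0//.
by rewrite exprMn !enorm_sqr dotp_sqr_le.
Qed.

Lemma dotp_le n (u v : 'rV[R]_n) : dotp u v <= enorm u * enorm v.
Proof. exact: le_trans (ler_norm _) (dotp_norm_le _ _). Qed.

Lemma enormD n (u v : 'rV[R]_n) : enorm (u + v) <= enorm u + enorm v.
Proof.
rewrite enorm_le ?addr_ge0 ?enorm_ge0// !(dotpDl, dotpDr) (dotpC v u) sqrrD.
by rewrite !enorm_sqr; have := dotp_le u v; lra.
Qed.

Lemma enormB n (u v : 'rV[R]_n) : enorm (u - v) <= enorm u + enorm v.
Proof. by rewrite (le_trans (enormD _ _))// enormN. Qed.

Lemma enormZ n a (u : 'rV[R]_n) : enorm (a *: u) = `|a| * enorm u.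
Proof. by rewrite /enorm dotpZl dotpZr mulrA -expr2 sqrtrM ?sqr_ge0// sqrtr_sqr. Qed.

Lemma le_coord_enorm n (u : 'rV[R]_n) i : `|u 0 i| <= enorm u.
Proof.
rewrite -(dotp_delta u) (le_trans (dotp_norm_le _ _))// ler_piMr ?enorm_ge0//.
by rewrite enorm_le// dotp_delta mxE !eqxx expr1n.
Qed.

(** A frame is a total function on [nat] of which only the first k values are constrained, so that
    it can be extended by one vector without changing its type. *)
Definition orthonormal n k (u : nat -> 'rV[R]_n) : Prop :=
  forall i j, (i < k)%N -> (j < k)%N -> dotp (u i) (u j) = (i == j)%:R.

Lemma dotp_orthonormal_sum_ord n k (u : nat -> 'rV[R]_n) (a : 'I_k -> R) (j : 'I_k) :
  orthonormal k u -> dotp (u j) (\sum_(i < k) a i *: u i) = a j.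
Proof.
move=> ou; rewrite dotp_sumr (bigD1 j)//= big1 => [|i ij].
  by rewrite dotpZr ou// eqxx mulr1 addr0.
by rewrite dotpZr ou// eq_sym (negPf (ij : (i : nat) != j)) mulr0.
Qed.

Lemma dotp_orthonormal_sum n k (u : nat -> 'rV[R]_n) (a : nat -> R) j :
  orthonormal k u -> (j < k)%N ->
  dotp (u j) (\sum_(i < k) a i *: u i) = a j.
Proof. by move=> ou jk; exact: (dotp_orthonormal_sum_ord a (Ordinal jk) ou). Qed.

Lemma sqr_orthonormal_sum n k (u : nat -> 'rV[R]_n) (a : 'I_k -> R) :
  orthonormal k u ->
  dotp (\sum_(i < k) a i *: u i) (\sum_(i < k) a i *: u i) = \sum_(i < k) a i ^+ 2.
Proof.
move=> ou; rewrite {1}dotp_suml; apply: eq_bigr => i _.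
by rewrite dotpZl dotp_orthonormal_sum_ord// -expr2.
Qed.

Lemma bessel n k (u : nat -> 'rV[R]_n) (x : 'rV[R]_n) : orthonormal k u ->
  \sum_(i < k) dotp (u i) x ^+ 2 <= dotp x x.
Proof.
move=> ou; set y := \sum_(i < k) dotp (u i) x *: u i.
have := dotp_ge0 (x - y); rewrite !(dotpBl, dotpBr) (dotpC y x).
have -> : dotp y y = \sum_(i < k) dotp (u i) x ^+ 2.
  exact: (sqr_orthonormal_sum (fun i : 'I_k => dotp (u i) x)).
have -> : dotp x y = \sum_(i < k) dotp (u i) x ^+ 2.
  by rewrite dotp_sumr; apply: eq_bigr => i _; rewrite dotpZr (dotpC x) -expr2.
by lra.
Qed.

(** The matrix whose columns are the vectors of s has more rows than columns, hence a nonzero left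
    kernel; any vector in it can be normalised. *)
Lemma orthogonal_unit d (s : seq 'rV[R]_d) : (size s < d)%N ->
  exists2 v : 'rV[R]_d, dotp v v = 1 & forall x, x \in s -> dotp v x = 0.
Proof.
move=> sd; pose A : 'M[R]_(d, size s) := \matrix_(i, j) (nth 0 s j) 0 i.
have : kermx A != 0.
  by rewrite -mxrank_eq0 mxrank_ker -lt0n subn_gt0 (leq_ltn_trans _ sd)// rank_leq_col.
case/rowV0Pn => w /sub_kermxP wA w0.
have wp : 0 < dotp w w.
  by rewrite lt_neqAle dotp_ge0 andbT eq_sym; apply: contra_neq w0; exact: dotp_eq0.
exists ((enorm w)^-1 *: w).
  rewrite dotpZl dotpZr mulrA -expr2 exprVn enorm_sqr mulVf// gt_eqF//.
move=> x /(nthP 0)[j js <-]; rewrite dotpZl.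
have := congr1 (fun B : 'M[R]_(1, size s) => B 0 (Ordinal js)) wA.
rewrite !mxE => h; rewrite /dotp; set S := (X in _ * X).
have -> : S = 0 by rewrite -h; apply: eq_bigr => i _; rewrite mxE.
by rewrite mulr0.
Qed.

Lemma orthogonal_frame d m (s : seq 'rV[R]_d) : (size s + m <= d)%N ->
  exists2 b : nat -> 'rV[R]_d, orthonormal m b &
    forall i x, (i < m)%N -> x \in s -> dotp (b i) x = 0.
Proof.
elim: m => [|m IH] sm; first by exists (fun=> 0).
have [|b ob bs] := IH; first by rewrite (leq_trans _ sm)// leq_add2l.
have [|v v1 vs] := @orthogonal_unit d (s ++ [seq b i | i <- iota 0 m]).
  by rewrite size_cat size_map size_iota -addnS.
have vb i : (i < m)%N -> dotp v (b i) = 0.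
  move=> im; apply: vs; rewrite mem_cat; apply/orP; right.
  by apply/map_f; rewrite mem_iota.
exists (fun i => if i == m then v else b i).
  move=> i j; rewrite !ltnS => im jm.
  move: im jm; rewrite [(i <= m)%N]leq_eqVlt [(j <= m)%N]leq_eqVlt => /predU1P[->|im] /predU1P[->|jm].
  - by rewrite !eqxx.
  - by rewrite eqxx (ltn_eqF jm) vb// (gtn_eqF jm).
  - by rewrite eqxx (ltn_eqF im) dotpC vb// (ltn_eqF im).
  - by rewrite (ltn_eqF im) (ltn_eqF jm) ob.
move=> i x; rewrite ltnS leq_eqVlt => /predU1P[->|im] xs.
  by rewrite eqxx vs// mem_cat xs.
by rewrite (ltn_eqF im) bs.
Qed.

End EuclideanGeometry.

(** * The flat function x e^(-1/x) *)

Section FlatFunctions.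
Context {R : realType}.
Implicit Types (P : {poly R}) (x y : R).

Lemma is_deriveM_fun (f g : R -> R) x (a b : R) : is_derive x 1 f a ->
  is_derive x 1 g b -> is_derive x 1 (fun z => f z * g z) (f x * b + g x * a).
Proof. exact: is_deriveM. Qed.

Lemma is_deriveD_fun (f g : R -> R) x (a b : R) : is_derive x 1 f a ->
  is_derive x 1 g b -> is_derive x 1 (fun z => f z + g z) (a + b).
Proof. exact: is_deriveD. Qed.

Lemma is_deriveMl_fun (f : R -> R) c x (a : R) : is_derive x 1 f a ->
  is_derive x 1 (fun z => c * f z) (c * a).
Proof.
move=> fa; apply: (is_derive_eq (is_deriveM_fun (is_derive_cst c x (1 : R)) fa)).
by rewrite mulr0 addr0.
Qed.

(** The functions P(1/x) e^(-1/x), extended by 0, form a class that is closed under differentiation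
    and consists of bounded functions. *)
Definition expinv P x : R := if 0 < x then P.[x^-1] * expR (- x^-1) else 0.

Lemma expinv_le0 P x : x <= 0 -> expinv P x = 0.
Proof. by move=> x0; rewrite /expinv ltNge x0. Qed.

Lemma expinvXM P x : expinv P x = x * expinv ('X * P) x.
Proof.
rewrite /expinv; case: ifPn => [x0|_]; last by rewrite mulr0.
by rewrite hornerM hornerX -mulrA mulVKf// gt_eqF.
Qed.

(** With y = 1/x, each monomial obeys y^i e^(-y) <= (i+1)!, from the Taylor bound e^y >= y^(i+1) /
    (i+1)! when y > 1, and trivially when y <= 1. *)
Lemma expinv_bounded P : exists2 K, 0 <= K & forall x, `|expinv P x| <= K.
Proof.
exists (\sum_(i < size P) `|P`_i| * (i.+1)`!%:R).
  by apply: sumr_ge0 => i _; rewrite mulr_ge0.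
move=> x; rewrite /expinv; case: ifPn => [x0|_]; last first.
  by rewrite normr0 sumr_ge0// => i _; rewrite mulr_ge0.
have y0 : 0 <= x^-1 by rewrite invr_ge0 ltW.
rewrite normrM (ger0_norm (expR_ge0 _)) horner_coef.
apply: le_trans (ler_wpM2r (expR_ge0 _) (ler_norm_sum _ _ _)) _.
rewrite mulr_suml ler_sum// => i _.
rewrite normrM -mulrA ler_wpM2l// ger0_norm ?exprn_ge0//.
rewrite expRN ler_pdivrMr ?expR_gt0//.
have le1 : 1 <= (i.+1)`!%:R :> R by rewrite ler1n fact_gt0.
have [y1|y1] := leP (x^-1) 1.
  rewrite (@le_trans _ _ 1)// ?exprn_ile1//.
  by rewrite mulr_ege1// -[leLHS]expR0 ler_expR.
rewrite (@le_trans _ _ (x^-1 ^+ i.+1))// ?ler_eXn2l//.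
rewrite mulrC -ler_pdivrMr ?ltr0n ?fact_gt0//.
by apply: le_trans (expR_ge1Dxn i y0); rewrite lerDr ler01.
Qed.

(** Differentiating P(1/x) e^(-1/x) gives x^(-2) (P - P')(1/x) e^(-1/x). *)
Definition expinv_next P : {poly R} := 'X^2 * (P - P^`()).

Lemma is_derive_expinv P x : is_derive x 1 (expinv P) (expinv (expinv_next P) x).
Proof.
have [x0|x0|x0] := ltgtP x 0.
- apply: (@near_eq_is_derive _ _ _ (cst 0)).
    near=> z; rewrite expinv_le0//; apply: ltW; near: z.
    exact: lt_nbhsl.
  by rewrite expinv_le0 ?ltW//; exact: is_derive_cst.
- suff : is_derive x 1 (fun z : R => P.[z^-1] * expR (- z^-1) : R) (expinv (expinv_next P) x).
    apply: near_eq_is_derive.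
    near=> z; rewrite /expinv ifT//; near: z.
    exact: lt_nbhsr.
  have x0' : x != 0 by rewrite gt_eqF.
  have dV : is_derive x 1 (fun z : R => z^-1) (- x ^- 2).
    apply: is_derive_eq; first exact: (@is_deriveV _ id).
    by rewrite /= /GRing.scale/= mulr1.
  have d1 : is_derive x 1 (fun z : R => P.[z^-1]) (P^`().[x^-1] * - x ^- 2).
    by apply: (@is_derive1_comp _ (horner P)).
  have d2 : is_derive x 1 (fun z : R => expR (- z^-1)) (expR (- x^-1) * - - x ^- 2).
    by apply: (@is_derive1_comp _ expR (fun z => - z^-1)); exact: is_deriveN.
  apply: (is_derive_eq (is_deriveM_fun d1 d2)).
  rewrite /expinv x0 /expinv_next hornerM hornerXn hornerD hornerN exprVn.
  by field.
(* At the junction the slope function is [expinv ('X * P)], by [expinvXM]. The same identity writes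
   it as z times a bounded function, so it tends to 0. *)
- rewrite x0 expinv_le0//; apply/is_derive1_caratheodory.
  exists (expinv ('X * P)); split; last by rewrite expinv_le0.
    by move=> z; rewrite subr0 (expinv_le0 P (lexx 0)) subr0 expinvXM mulrC.
  have [K K0 HK] := expinv_bounded ('X * ('X * P)).
  apply/cvgrPdist_lt => e e0; rewrite (expinv_le0 _ (lexx 0)).
  have d0 : 0 < e / (K + 1) by rewrite divr_gt0// ltr_wpDl.
  near=> z; rewrite sub0r normrN expinvXM normrM.
  have : `|z| < e / (K + 1).
    by rewrite -[z]subr0 distrC; near: z; exact: (@cvgr_dist_lt _ _ _ (nbhs 0) _ id).
  rewrite ltr_pdivlMr ?ltr_wpDl// => h; apply: le_lt_trans h.
  by rewrite ler_wpM2l// (le_trans (HK z))// lerDl ler01.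
Unshelve. all: by end_near. Qed.

(** One-variable functions carry all their derivatives as an explicit sequence, so that bounds and
    flatness can be read off at every order. *)
Definition derivs (a : nat -> R -> R) := forall k x, is_derive x 1 (a k) (a k.+1 x).

(** Order 0 grows linearly and is not in the bounded class [expinv]; from order 1 on, starting with
    (1 + 1/x) e^(-1/x), all derivatives are. *)
Definition flat (k : nat) x : R :=
  if k is k'.+1 then expinv (iter k' expinv_next (1 + 'X)) x else x * expinv 1 x.

Lemma flatE x : flat 0 x = if 0 < x then x * expR (- x^-1) else 0.
Proof. by rewrite /flat /expinv hornerC mul1r; case: ifP; rewrite ?mulr0. Qed.

Lemma flat_le0 k x : x <= 0 -> flat k x = 0.
Proof. by case: k => [|k] x0; rewrite /flat expinv_le0// mulr0. Qed.

Lemma flat_derivs : derivs flat.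
Proof.
case=> [|k] x; last exact: is_derive_expinv.
apply: is_derive_eq.
  exact: (@is_deriveM_fun id (expinv 1) _ _ _ (is_derive_id _ _) (is_derive_expinv _ _)).
rewrite /flat /expinv /=; case: ifPn => x0; last by ring.
have x0' : x != 0 by rewrite gt_eqF.
rewrite /expinv_next derivC subr0 hornerM hornerXn hornerD hornerX hornerC exprVn.
by field.
Qed.

Lemma flat_bounded k : exists2 K, 0 <= K & forall x, `|flat k.+1 x| <= K.
Proof. exact: expinv_bounded. Qed.

Lemma flat_ge0 x : 0 <= flat 0 x.
Proof. by rewrite flatE; case: ifP => // x0; rewrite mulr_ge0 ?expR_ge0// ltW. Qed.

Lemma flat_le x : flat 0 x <= Num.max x 0.
Proof.
rewrite flatE; case: ifPn => x0; last by rewrite le_max lexx orbT.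
rewrite le_max ler_piMr//; first exact: ltW.
by rewrite -expR0 ler_expR oppr_le0 invr_ge0 ltW.
Qed.

Lemma flat_ge x : x - 1 <= flat 0 x.
Proof.
rewrite flatE; case: ifPn => x0; last by rewrite -leNgt in x0; lra.
have := ler_wpM2l (ltW x0) (expR_ge1Dx (- x^-1)).
by rewrite mulrDr mulr1 mulrN divff ?gt_eqF.
Qed.

(* x e^{-1/x} is the perspective of u |-> e^{-u}, hence the supremum of its
   tangents. *)
Lemma flat_tangent x y : 0 < y -> expR (- y^-1) * (x - 1 + x / y) <= flat 0 x.
Proof.
move=> y0; rewrite flatE; case: ifPn => x0.
  have := ler_wpM2l (ltW x0) (expR_ge1Dx (y^-1 - x^-1)).
  move=> /(ler_wpM2l (expR_ge0 (- y^-1))).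
  rewrite [leRHS]mulrCA -expRD addKr => h; apply: le_trans h.
  rewrite le_eqVlt; apply/orP; left; apply/eqP; congr (_ * _).
  by field; rewrite !gt_eqF.
rewrite -leNgt in x0; rewrite mulr_ge0_le0 ?expR_ge0//.
have : x / y <= 0 by rewrite mulr_le0_ge0// invr_ge0 ltW.
by lra.
Qed.

(** If the combination z is positive, averaging the tangent bounds at z gives e^(-1/z) (z - 1 +
    z/z), the exact value at z. Otherwise the left side is 0. *)
Lemma flat_convex x y (t : R) : 0 <= t -> t <= 1 ->
  flat 0 (t * x + (1 - t) * y) <= t * flat 0 x + (1 - t) * flat 0 y.
Proof.
move=> t0 t1; have t1' : 0 <= 1 - t by rewrite subr_ge0.
set z := t * x + _; have [z0|z0] := leP z 0.
  by rewrite flat_le0// addr_ge0// mulr_ge0// flat_ge0.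
have := lerD (ler_wpM2l t0 (flat_tangent x z0)) (ler_wpM2l t1' (flat_tangent y z0)).
apply: le_trans; rewrite flatE z0 le_eqVlt; apply/orP; left; apply/eqP.
rewrite !(mulrCA _ (expR _)) -mulrDr mulrC; congr (_ * _).
rewrite [RHS](_ : _ = z - 1 + z / z); first by rewrite divff ?gt_eqF//; lra.
by rewrite {3 4}/z; ring.
Qed.

End FlatFunctions.

(** * The coupling of two real variables *)

Section Coupling.
Context {R : realType}.
Implicit Types (s t x y : R).

Lemma derivs_lip (a : nat -> R -> R) k K : derivs a ->
  (forall x, `|a k.+1 x| <= K) -> forall x y, `|a k x - a k y| <= K * `|x - y|.
Proof.
move=> da aK; suff h x y : x <= y -> `|a k x - a k y| <= K * `|x - y|.
  by move=> x y; case/orP: (le_total x y) => [/h//|/h]; rewrite distrC (distrC y).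
move=> xy; have [|c _ e] := @MVT_segment _ (a k) (a k.+1) _ _ xy (fun z _ => da k z).
  apply: derivable_within_continuous => z _; exact: ex_derive.
by rewrite distrC e normrM (distrC x) ler_wpM2r.
Qed.

(** The index k is the order of differentiation; the sign comes from the inner map s -> -s. At order
    0 these are the even and odd combinations of two flat functions, both zero on [-1, 1]. *)
Definition evenflat k s : R := flat k (s - 1) + (-1) ^+ k * flat k (- s - 1).
Definition oddflat k s : R := flat k (s - 1) - (-1) ^+ k * flat k (- s - 1).
Definition monod k s : R := if k is 0 then s else (k == 1)%:R.
(** [monod] lists the derivatives s, 1, 0, 0, ... of the identity. Order 0 of [satur] is a smooth
    truncation theta of the identity: equal to s on [-1, 1] and bounded. *)
Definition satur k s : R := monod k s - oddflat k s.

Lemma derivs_comp_affine (a : nat -> R -> R) c d : derivs a ->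
  forall k x, is_derive x 1 (fun z => a k (c * z + d)) (c * a k.+1 (c * x + d)).
Proof.
move=> da k x; rewrite mulrC.
have h : is_derive x (1 : R) (fun z : R => c * z + d) (c * 1 + 0).
  exact: is_deriveD_fun (is_deriveMl_fun c (is_derive_id x (1 : R))) (is_derive_cst d x (1 : R)).
rewrite mulr1 addr0 in h.
exact: (@is_derive1_comp _ _ (fun z => c * z + d) _ _ _ (da k _) h).
Qed.

Lemma derivsD (a b : nat -> R -> R) : derivs a -> derivs b ->
  derivs (fun k s => a k s + b k s).
Proof. by move=> da db k x; apply: is_deriveD_fun. Qed.

Lemma derivsZ c (a : nat -> R -> R) : derivs a -> derivs (fun k s => c * a k s).
Proof. by move=> da k x; apply: is_deriveMl_fun. Qed.

Lemma flat_comp_derivs (a e : R) :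
  derivs (fun k s => e ^+ k * flat k (e * s + a)).
Proof.
move=> k x; rewrite exprSr -mulrA.
by apply: is_deriveMl_fun; exact: (derivs_comp_affine _ _ flat_derivs).
Qed.

Lemma monod_derivs : derivs monod.
Proof.
case=> [|[|k]] x; first exact: (is_derive_id x (1 : R)).
  exact: (is_derive_cst (1 : R) x (1 : R)).
exact: (is_derive_cst (0 : R) x (1 : R)).
Qed.

Lemma oned_derivs : derivs (fun k (_ : R) => (k == 0)%:R).
Proof. by case=> [|k] x; [exact: (is_derive_cst (1 : R) x (1 : R))|exact: (is_derive_cst (0 : R) x (1 : R))]. Qed.

Lemma evenflat_derivs : derivs evenflat.
Proof.
apply: derivsD.
  by have := flat_comp_derivs (-1) 1; under eq_fun do under eq_fun do rewrite expr1n !mul1r.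
by have := flat_comp_derivs (-1) (-1); under eq_fun do under eq_fun do rewrite mulN1r.
Qed.

Lemma oddflat_derivs : derivs oddflat.
Proof.
apply: derivsD.
  by have := flat_comp_derivs (-1) 1; under eq_fun do under eq_fun do rewrite expr1n !mul1r.
have := derivsZ (-1) (flat_comp_derivs (-1) (-1)).
by under eq_fun do under eq_fun do rewrite !mulN1r.
Qed.

Lemma satur_derivs : derivs satur.
Proof.
apply: derivsD; first exact: monod_derivs.
by have := derivsZ (-1) oddflat_derivs; under eq_fun do under eq_fun do rewrite mulN1r.
Qed.

Lemma evenflat_bounded k : exists2 K, 0 <= K & forall x, `|evenflat k.+1 x| <= K.
Proof.
have [K K0 HK] := @flat_bounded R k; exists (K + K); first by rewrite addr_ge0.
move=> x; rewrite (le_trans (ler_normD _ _))// lerD//.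
by rewrite normrM normrX normrN1 expr1n mul1r.
Qed.

(** For s > 1 the flat term lies between s - 2 and s - 1, so theta lies in [1, 2]; the case s < -1
    is the mirror image. *)
Lemma satur_bounded0 s : `|satur 0 s| <= 2.
Proof.
have h1 := flat_ge (s - 1); have h2 := flat_ge (- s - 1).
have h3 := flat_le (s - 1); have h4 := flat_le (- s - 1).
have h5 := flat_ge0 (s - 1); have h6 := flat_ge0 (- s - 1).
rewrite /satur /oddflat /monod expr0 mul1r ler_norml.
have [s1|s1] := leP s (-1).
  rewrite (@flat_le0 _ _ (s - 1)); last lra.
  by rewrite max_l in h4; lra.
have [s2|s2] := leP s 1.
  by rewrite !flat_le0; lra.
rewrite (@flat_le0 _ _ (- s - 1)); last lra.
by rewrite max_l in h3; lra.
Qed.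

Lemma satur_bounded k : exists2 K, 0 <= K & forall x, `|satur k x| <= K.
Proof.
case: k => [|k]; first by exists 2 => //; exact: satur_bounded0.
have [K K0 HK] := @flat_bounded R k; exists (1 + (K + K)).
  by rewrite !addr_ge0.
move=> x; rewrite (le_trans (ler_normB _ _))// lerD//.
  by rewrite /monod; case: eqP; rewrite ?normr1 ?normr0.
rewrite (le_trans (ler_normB _ _))// lerD//.
by rewrite normrM normrX normrN1 expr1n mul1r.
Qed.

(* coupling i j s t is the partial derivative of order (i, j) of
   coupling 0 0 s t = 2 G(s) - 2 G(t) + s t - theta(s) theta(t),
   with G = evenflat 0 and theta = satur 0. *)
Definition coupling i j s t : R :=
  2 * evenflat i s * (j == 0)%:R - 2 * (i == 0)%:R * evenflat j t +
  monod i s * monod j t - satur i s * satur j t.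

Lemma coupling00E s t : coupling 0 0 s t =
  2 * evenflat 0 s - 2 * evenflat 0 t + s * t - satur 0 s * satur 0 t.
Proof. by rewrite /coupling /= !mulr1. Qed.

(** G is even and theta is odd. This symmetry turns convexity in the first variable into concavity
    in the second. *)
Lemma coupling_anti s t : coupling 0 0 s t = - coupling 0 0 t (- s).
Proof.
rewrite !coupling00E /satur /oddflat /evenflat /= !expr0 !opprK.
by ring.
Qed.

Lemma evenflat_eq0 k s : `|s| <= 1 -> evenflat k s = 0.
Proof. by rewrite ler_norml => s1; rewrite /evenflat !flat_le0 ?mulr0 ?addr0//; lra. Qed.

Lemma oddflat_eq0 k s : `|s| <= 1 -> oddflat k s = 0.
Proof. by rewrite ler_norml => s1; rewrite /oddflat !flat_le0 ?mulr0 ?subr0//; lra. Qed.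

Lemma coupling_flat i j s t : `|s| <= 1 -> `|t| <= 1 -> coupling i j s t = 0.
Proof.
move=> s1 t1; rewrite /coupling /satur !evenflat_eq0// !oddflat_eq0//.
by rewrite !subr0; ring.
Qed.

(** Only -2 G(t) is left at s = 0. It is applied at the test point x', where every first argument
    vanishes. *)
Lemma coupling0_le0 t : coupling 0 0 0 t <= 0.
Proof.
rewrite coupling00E /satur evenflat_eq0 ?normr0// oddflat_eq0 ?normr0//=.
rewrite /evenflat expr0 mul1r; have := flat_ge0 (t - 1); have := flat_ge0 (- t - 1).
by lra.
Qed.

(** The term 2 G(s) is dropped, 2 G(m) <= 2 m since G(m) is at most max(m - 1, 0), and |theta theta|
    <= 4. *)
Lemma coupling_ge s m : 0 <= m -> s * m - 2 * m - 4 <= coupling 0 0 s m.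
Proof.
move=> m0; have h : `|satur 0 s * satur 0 m| <= 4.
  rewrite normrM (_ : 4 = 2 * 2); last by lra.
  by rewrite ler_pM// satur_bounded0.
have := ler_norm (satur 0 s * satur 0 m).
rewrite coupling00E /evenflat expr0 !mul1r.
have := flat_ge0 (s - 1); have := flat_ge0 (- s - 1).
have := flat_le (m - 1); rewrite (@flat_le0 _ _ (- m - 1)); last lra.
by move: (flat 0 (m - 1)) (satur 0 s * satur 0 m) h => a b ab;
   case: (leP (m - 1) 0) => _; lra.
Qed.

(** For fixed t and c = theta(t), the coupling is (2 + c) flat(s - 1) + (2 - c) flat(-s - 1) plus an
    affine function of s. The factor 2 in front of G is the bound on |theta|, which makes both
    weights nonnegative. *)
Lemma coupling_convexl t x y (l : R) : 0 <= l -> l <= 1 ->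
  coupling 0 0 (l * x + (1 - l) * y) t <=
  l * coupling 0 0 x t + (1 - l) * coupling 0 0 y t.
Proof.
move=> l0 l1; set c := satur 0 t.
have E s : coupling 0 0 s t = (2 + c) * flat 0 (s - 1) + (2 - c) * flat 0 (- s - 1)
    + s * (t - c) - 2 * evenflat 0 t.
  rewrite coupling00E -/c /evenflat /satur /oddflat /= expr0; ring.
rewrite !E; have := satur_bounded0 t; rewrite -/c ler_norml => /andP[c1 c2].
have p1 : 0 <= 2 + c by lra.
have p2 : 0 <= 2 - c by lra.
have := ler_wpM2l p1 (flat_convex (x - 1) (y - 1) l0 l1).
have := ler_wpM2l p2 (flat_convex (- x - 1) (- y - 1) l0 l1).
rewrite (_ : l * (- x - 1) + _ = - (l * x + (1 - l) * y) - 1); last by ring.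
rewrite (_ : l * (x - 1) + _ = l * x + (1 - l) * y - 1); last by ring.
set A := flat 0 _; set B := flat 0 _; set A' := flat 0 _; set B' := flat 0 _.
set A'' := flat 0 _; set B'' := flat 0 _.
by move=> h1 h2; apply: le_trans (lerD (lerD (lerD h2 h1) (lexx _)) (lexx _)) _;
   rewrite le_eqVlt; apply/orP; left; apply/eqP; ring.
Qed.

Lemma coupling_concaver s x y (l : R) : 0 <= l -> l <= 1 ->
  l * coupling 0 0 s x + (1 - l) * coupling 0 0 s y <=
  coupling 0 0 s (l * x + (1 - l) * y).
Proof.
move=> l0 l1; rewrite !(coupling_anti s) !mulrN -opprD lerN2.
exact: coupling_convexl.
Qed.

(** From total order two on, the derivatives of s t are constant and cancel in the difference; this
    is where p >= 2 enters. What remains is built from functions that are bounded together with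
    their next derivative. *)
Lemma coupling_lip (p : nat) : (2 <= p)%N -> exists2 K, 0 <= K &
  forall i j s t s' t', (i + j = p)%N ->
    `|coupling i j s t - coupling i j s' t'| <= K * (`|s - s'| + `|t - t'|).
Proof.
move=> p2.
have [K0 K00 HK0] := evenflat_bounded p.
have /choice[B HB] : forall k, exists K, 0 <= K /\ forall x, `|satur k x| <= K.
  by move=> k; have [K ? ?] := satur_bounded k; exists K.
(* Orders up to p + 1 are covered, because a Lipschitz bound at order p uses one more derivative. *)
pose K1 := \sum_(k < p.+2) B k.
have B0 k : 0 <= B k by case: (HB k).
have HK1 k x : (k < p.+2)%N -> `|satur k x| <= K1.
  move=> kp; have [_ /(_ x) h] := HB k; apply: le_trans h _.
  by rewrite /K1 (bigD1 (Ordinal kp))//= lerDl sumr_ge0.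
have K10 : 0 <= K1 by apply: sumr_ge0.
exists (2 * K0 + 2 * K0 + K1 * K1); first by rewrite !addr_ge0 ?mulr_ge0.
move=> i j s t s' t' ij.
have mono : monod i s * monod j t = monod i s' * monod j t'.
  by move: i j ij => [|[|i]] [|[|j]] ij //=; rewrite ?mulr0 ?mul0r//; move: p2; rewrite -ij.
rewrite /coupling mono; set m := monod i s' * monod j t'.
have -> (a b c a' b' c' : R) : a - b + m - c - (a' - b' + m - c') =
  (a - a') - (b - b') - (c - c') by ring.
have h1 : `|2 * evenflat i s * (j == 0)%:R - 2 * evenflat i s' * (j == 0)%:R|
    <= 2 * K0 * (`|s - s'| + `|t - t'|).
  case: eqP => [j0|_]; last by rewrite !mulr0 subr0 normr0 !mulr_ge0 ?addr_ge0.
  have -> : i = p by rewrite -ij j0 addn0.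
  rewrite !mulr1 -mulrBr normrM ger0_norm// -mulrA ler_wpM2l//.
  apply: le_trans (derivs_lip evenflat_derivs HK0 _ _) _.
  by rewrite ler_wpM2l// lerDl.
have h2 : `|2 * (i == 0)%:R * evenflat j t - 2 * (i == 0)%:R * evenflat j t'|
    <= 2 * K0 * (`|s - s'| + `|t - t'|).
  case: eqP => [i0|_]; last by rewrite !mulr0 !mul0r subr0 normr0 !mulr_ge0 ?addr_ge0.
  have -> : j = p by rewrite -ij i0.
  rewrite !mulr1 -mulrBr normrM ger0_norm// -mulrA ler_wpM2l//.
  apply: le_trans (derivs_lip evenflat_derivs HK0 _ _) _.
  by rewrite ler_wpM2l// lerDr.
have ip : (i < p.+1)%N by rewrite ltnS -ij leq_addr.
have jp : (j < p.+1)%N by rewrite ltnS -ij leq_addl.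
have h3 : `|satur i s * satur j t - satur i s' * satur j t'|
    <= K1 * K1 * (`|s - s'| + `|t - t'|).
  have -> : satur i s * satur j t - satur i s' * satur j t' =
    (satur i s - satur i s') * satur j t + satur i s' * (satur j t - satur j t') by ring.
  rewrite (le_trans (ler_normD _ _))// [leRHS]mulrDr !normrM lerD//.
    rewrite mulrAC ler_pM//; last by rewrite HK1// ltnW.
    by apply: derivs_lip satur_derivs _ _ _ => x; exact: HK1.
  rewrite -mulrA ler_pM//; first by rewrite HK1// ltnW.
  by apply: derivs_lip satur_derivs _ _ _ => x; exact: HK1.
apply: le_trans (ler_normB _ _) _; rewrite [leRHS]mulrDl; apply: lerD h3.
by apply: le_trans (ler_normB _ _) _; rewrite [leRHS]mulrDl; apply: lerD h1 h2.
Qed.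

End Coupling.

(** * Iterated directional derivatives *)

Section DirectionalDerivatives.
Context {R : realType} {n : nat}.
Implicit Types (f g : 'rV[R]_n -> R) (df dg : 'rV[R]_n -> 'rV[R]_n -> R).

(** Pairs Frechet differentiability, which [Ck] asks for, with a formula for the directional
    derivatives, from which [Dform] is built. *)
Definition hasD f df : Prop :=
  forall z, differentiable f z /\ forall v, 'D_v f z = df v z.

Lemma hasD_ext f df f' df' : hasD f df -> f =1 f' -> (forall v, df v =1 df' v) ->
  hasD f' df'.
Proof.
move=> fD /funext <- dfE z; have [d e] := fD z; split=> // v.
by rewrite e dfE.
Qed.

Lemma hasD_cst c : hasD (fun=> c) (fun _ _ => 0).
Proof.
move=> z; split; first exact: differentiable_cst.
by move=> v; rewrite (derive_val (is_derive := is_derive_cst c z v)).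
Qed.

Lemma hasD_add f df g dg : hasD f df -> hasD g dg ->
  hasD (fun z => f z + g z) (fun v z => df v z + dg v z).
Proof.
move=> fD gD z; have [d e] := fD z; have [d' e'] := gD z.
split; first exact: differentiableD.
by move=> v; rewrite deriveD ?e ?e'//; exact: diff_derivable.
Qed.

Lemma hasD_mul f df g dg : hasD f df -> hasD g dg ->
  hasD (fun z => f z * g z) (fun v z => df v z * g z + f z * dg v z).
Proof.
move=> fD gD z; have [d e] := fD z; have [d' e'] := gD z.
split; first exact: differentiableM.
move=> v; rewrite deriveM; [|exact: diff_derivable..].
by rewrite e e' addrC mulrC.
Qed.

Lemma hasD_scale c f df : hasD f df -> hasD (fun z => c * f z) (fun v z => c * df v z).
Proof.
move=> fD; apply: hasD_ext (hasD_mul (hasD_cst c) fD) _ _ => // v z.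
by rewrite mul0r add0r.
Qed.

Lemma hasD_sum k (f : nat -> 'rV[R]_n -> R) (df : nat -> 'rV[R]_n -> 'rV[R]_n -> R) :
  (forall i, (i < k)%N -> hasD (f i) (df i)) ->
  hasD (fun z => \sum_(i < k) f i z) (fun v z => \sum_(i < k) df i v z).
Proof.
elim: k => [|k IH] fD.
  by apply: hasD_ext (hasD_cst 0) _ _ => [z|v z]; rewrite big_ord0.
apply: hasD_ext (hasD_add (IH _) (fD k _)) _ _ => // [i ik|z|v z].
- by apply: fD; rewrite ltnW.
- by rewrite big_ord_recr.
- by rewrite big_ord_recr.
Qed.

Lemma hasD_dotp (a : 'rV[R]_n) : hasD (fun z => dotp a z) (fun v _ => dotp a v).
Proof.
have h i : hasD (fun z => (z 0 i : R)) (fun v _ => v 0 i).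
  move=> z; split; first exact: differentiable_coord.
  move=> v; apply: derive_val; split.
    exact/diff_derivable/differentiable_coord.
  rewrite /derive; apply: cvg_lim => //; apply/cvgrPdist_lt => e e0.
  near=> h; rewrite /= !mxE addrK /GRing.scale/= mulKf ?subrr ?normr0//.
  by near: h; exact: nbhs_dnbhs_neq.
(* [hasD_sum] takes families indexed by [nat], so the coordinate functions are extended by 0 beyond
   n. *)
pose F i (z : 'rV[R]_n) : R := if insub i is Some j then a 0 j * z 0 j else 0.
pose dF i (v _ : 'rV[R]_n) : R := if insub i is Some j then a 0 j * v 0 j else 0.
have H : forall i, (i < n)%N -> hasD (F i) (dF i).
  by move=> i ik; rewrite /F /dF insubT; exact: hasD_scale.
apply: (hasD_ext (hasD_sum H)) => [z|v z].
- by apply: eq_bigr => i _; rewrite /F valK.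
- by apply: eq_bigr => i _; rewrite /dF valK.
Unshelve. all: by end_near. Qed.

Lemma hasD_comp (a : nat -> R -> R) k f df : derivs a -> hasD f df ->
  hasD (fun z => a k (f z)) (fun v z => df v z * a k.+1 (f z)).
Proof.
move=> da fD z; have [d e] := fD z.
have d1 : differentiable (a k) (f z).
  by apply/derivable1_diffP; case: (da k (f z)).
split; first exact: differentiable_comp.
move=> v; rewrite deriveE; last exact: differentiable_comp.
rewrite diff_comp//= (_ : 'd f z v = df v z); last by rewrite -deriveE.
rewrite diff1E//=.
by rewrite derive1E (derive_val (is_derive := da k (f z))).
Qed.

(** Says that E is a table of partial derivatives, in the form of the chain rule along arbitrary
    inner functions, so that no differentiability on the plane has to be set up. *)
Definition pderivs (E : nat -> nat -> R -> R -> R) : Prop :=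
  forall i j f df g dg, hasD f df -> hasD g dg ->
  hasD (fun z => E i j (f z) (g z))
    (fun v z => df v z * E i.+1 j (f z) (g z) + dg v z * E i j.+1 (f z) (g z)).

Lemma coupling_pderivs : pderivs coupling.
Proof.
have prod a b : derivs a -> derivs b -> pderivs (fun i j s t => a i s * b j t).
  move=> da db i j f df g dg fD gD.
  apply: hasD_ext (hasD_mul (hasD_comp i da fD) (hasD_comp j db gD)) _ _ => // v z.
  by ring.
move=> i j f df g dg fD gD.
have h1 := hasD_scale 2 (prod _ _ evenflat_derivs oned_derivs i j f df g dg fD gD).
have h2 := hasD_scale (-2) (prod _ _ oned_derivs evenflat_derivs i j f df g dg fD gD).
have h3 := prod _ _ monod_derivs monod_derivs i j f df g dg fD gD.
have h4 := hasD_scale (-1) (prod _ _ satur_derivs satur_derivs i j f df g dg fD gD).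
apply: hasD_ext (hasD_add (hasD_add (hasD_add h1 h2) h3) h4) _ _ => [z|v z].
  by rewrite /coupling; ring.
by rewrite /coupling; ring.
Qed.

(* mixed r i j s t is the derivative of order size r of E i j along the
   directions listed in r. *)
Fixpoint mixed (E : nat -> nat -> R -> R -> R) (r : seq (R * R)) i j s t : R :=
  if r is c :: r' then c.1 * mixed E r' i.+1 j s t + c.2 * mixed E r' i j.+1 s t
  else E i j s t.

Lemma mixed_pderivs E r : pderivs E -> pderivs (mixed E r).
Proof.
move=> dE; elim: r => [//|c r IH] i j f df g dg fD gD /=.
have h1 := hasD_scale c.1 (IH i.+1 j f df g dg fD gD).
have h2 := hasD_scale c.2 (IH i j.+1 f df g dg fD gD).
by apply: hasD_ext (hasD_add h1 h2) _ _ => // v z; ring.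
Qed.

(** Each direction c costs a factor |c.1| + |c.2|, and the expansion ends in entries of total order
    i + j + [size r] only. *)
Lemma mixed_lip E r K i j s t s' t' : 0 <= K ->
  (forall i' j', (i' + j' = i + j + size r)%N -> `|E i' j' s t - E i' j' s' t'| <= K) ->
  `|mixed E r i j s t - mixed E r i j s' t'| <= K * \prod_(c <- r) (`|c.1| + `|c.2|).
Proof.
move=> K0; elim: r i j => [|c r IH] i j H /=.
  by rewrite big_nil mulr1; apply: H; rewrite addn0.
have -> (a b x y x' y' : R) : a * x + b * y - (a * x' + b * y') =
  a * (x - x') + b * (y - y') by ring.
rewrite (le_trans (ler_normD _ _))// big_cons mulrCA mulrDl !normrM.
rewrite lerD// ler_wpM2l//; apply: IH => i' j' e; apply: H; rewrite e/=.
  by rewrite addSn addnS.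
by rewrite !addnS addSn.
Qed.

Lemma mixed_eq0 E r i j s t : (forall i' j', E i' j' s t = 0) -> mixed E r i j s t = 0.
Proof. by move=> E0; elim: r i j => //= c r IH i j; rewrite !IH !mulr0 addr0. Qed.

Section SumOfCouplings.
Variables (E : nat -> nat -> R -> R -> R) (T : nat) (c : R).
Variables (l m : nat -> 'rV[R]_n -> R) (dl dm : nat -> 'rV[R]_n -> R).
Hypothesis dE : pderivs E.
Hypothesis lD : forall k, hasD (l k) (fun v _ => dl k v).
Hypothesis mD : forall k, hasD (m k) (fun v _ => dm k v).

Let phi z := c * \sum_(k < T) E 0 0 (l k z) (m k z).
Let dirs k vs := [seq (dl k v, dm k v) | v <- vs].

(** The two claims feed each other: the formula for [vs] gives differentiability there, and this
    gives the formula for [v :: vs]. The inner functions have derivatives independent of z, so the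
    directions enter as constants and produce no further terms. *)
Lemma hasD_Dform vs : hasD (Dform phi vs) (fun v => Dform phi (v :: vs)) /\
  forall z, Dform phi vs z =
    c * \sum_(k < T) mixed E (dirs k vs) 0 0 (l k z) (m k z).
Proof.
have main ws : (forall z, Dform phi ws z =
      c * \sum_(k < T) mixed E (dirs k ws) 0 0 (l k z) (m k z)) ->
    hasD (Dform phi ws) (fun v z =>
      c * \sum_(k < T) mixed E (dirs k (v :: ws)) 0 0 (l k z) (m k z)).
  move=> H; have h k : (k < T)%N -> _ := fun=>
    @mixed_pderivs E (dirs k ws) dE 0 0 _ _ _ _ (lD k) (mD k).
  by apply: hasD_ext (hasD_scale c (hasD_sum h)) _ _.
suff H z : Dform phi vs z =
    c * \sum_(k < T) mixed E (dirs k vs) 0 0 (l k z) (m k z).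
  split=> //; apply: hasD_ext (main vs H) _ _ => // v z.
  by rewrite [RHS]/=; have [_ ->] := main vs H z.
elim: vs z => [//|v vs IH] z.
by rewrite [LHS]/=; have [_ ->] := main vs IH z.
Qed.

Lemma smooth_sum : smooth phi.
Proof.
move=> k; suff H vs : Ck k setT (Dform phi vs) by exact: (H [::]).
elim: k vs => [|k IH] vs /=.
  move=> z _; apply: differentiable_continuous.
  by have [/(_ z)[]] := hasD_Dform vs.
split=> [z _|v]; last exact: (IH (v :: vs)).
by have [/(_ z)[]] := hasD_Dform vs.
Qed.

End SumOfCouplings.

End DirectionalDerivatives.

(** * The chain function *)

Section Chain.
Context {R : realType} {d : nat}.
Implicit Types (u w : nat -> 'rV[R]_d) (x y : 'rV[R]_d) (z : 'rV[R]_(d + d)).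
Implicit Types (M del c : R).

(** The linear part of the first argument, with 0 in place of X_{-1}; [chain_x] adds the constant M
    / del to link 0. Directional derivatives involve the linear part only. *)
Definition chain_dx u del k z : R :=
  ((if k is k'.+1 then dotp (u k') (lsubmx z) else 0) - dotp (u k) (lsubmx z)) / del.
Definition chain_dy w del k z : R := dotp (w k) (rsubmx z) / del.
Definition chain_x u M del k z : R := chain_dx u del k z + (k == 0)%:R * (M / del).

Definition chain u w M del c T z : R :=
  c * \sum_(k < T) coupling 0 0 (chain_x u M del k z) (chain_dy w del k z).

Definition edge_vec u del k : 'rV[R]_(d + d) :=
  del^-1 *: row_mx ((if k is k'.+1 then u k' else 0) - u k) 0.

Lemma chain_dxE u del k z : chain_dx u del k z = dotp (edge_vec u del k) z.
Proof.
rewrite /edge_vec.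
rewrite -{2}(hsubmxK z) dotpZl dotp_row_mx dotp0l addr0 dotpBl mulrC /chain_dx.
by case: k => // ; rewrite dotp0l.
Qed.

Lemma chain_dyE w del k z : chain_dy w del k z = dotp (del^-1 *: (row_mx 0 (w k))) z.
Proof. by rewrite -{2}(hsubmxK z) dotpZl dotp_row_mx dotp0l add0r mulrC. Qed.

Lemma chain_dxB u del k z z' :
  chain_dx u del k (z - z') = chain_dx u del k z - chain_dx u del k z'.
Proof. by rewrite !chain_dxE dotpBr. Qed.

Lemma chain_dyB w del k z z' :
  chain_dy w del k (z - z') = chain_dy w del k z - chain_dy w del k z'.
Proof. by rewrite !chain_dyE dotpBr. Qed.

Lemma hasD_chain_x u M del k :
  hasD (chain_x u M del k) (fun v _ => chain_dx u del k v).
Proof.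
apply: hasD_ext (hasD_add (hasD_dotp (edge_vec u del k))
  (hasD_cst ((k == 0)%:R * (M / del)))) _ _ => [z|v z].
  by rewrite -chain_dxE.
by rewrite addr0 -chain_dxE.
Qed.

Lemma hasD_chain_dy w del k :
  hasD (chain_dy w del k) (fun v _ => chain_dy w del k v).
Proof.
apply: hasD_ext (hasD_dotp (del^-1 *: row_mx 0 (w k))) _ _ => [z|v z];
by rewrite -chain_dyE.
Qed.

Lemma chain_Dform u w M del c T vs z : Dform (chain u w M del c T) vs z =
  c * \sum_(k < T) mixed coupling [seq (chain_dx u del k v, chain_dy w del k v) | v <- vs]
    0 0 (chain_x u M del k z) (chain_dy w del k z).
Proof.
by have [_ ->] := hasD_Dform T c coupling_pderivs (hasD_chain_x u M del)
  (hasD_chain_dy w del) vs.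
Qed.

Lemma chain_hasD u w M del c T vs : hasD (Dform (chain u w M del c T) vs)
  (fun v => Dform (chain u w M del c T) (v :: vs)).
Proof.
by have [] := hasD_Dform T c coupling_pderivs (hasD_chain_x u M del)
  (hasD_chain_dy w del) vs.
Qed.

Lemma chain_smooth u w M del c T : smooth (chain u w M del c T).
Proof. exact: smooth_sum coupling_pderivs (hasD_chain_x _ _ _) (hasD_chain_dy _ _). Qed.

(** On the flat square every mixed derivative of a link is 0, so the last links drop out of the
    whole jet at once. *)
Lemma chain_Dform_flat u w M del c k T vs z : (k <= T)%N ->
  (forall i, (k <= i < T)%N -> `|chain_x u M del i z| <= 1 /\ `|chain_dy w del i z| <= 1) ->
  Dform (chain u w M del c T) vs z = Dform (chain u w M del c k) vs z.
Proof.
elim: T => [|T IH]; first by rewrite leqn0 => /eqP ->.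
rewrite leq_eqVlt => /predU1P[->//|]; rewrite ltnS => kT H.
rewrite -IH// => [|i /andP[ki iT]]; last by apply: H; rewrite ki ltnW.
have [|h1 h2] := H T; first by rewrite kT leqnn.
rewrite !chain_Dform big_ord_recr/= [mixed _ _ _ _ _ _ in LHS]mixed_eq0 ?addr0//.
by move=> i j; exact: coupling_flat.
Qed.

Section Smoothness.
Variables (u w : nat -> 'rV[R]_d) (M del c : R) (T : nat).
Hypotheses (del0 : 0 < del) (ou : orthonormal T u) (ow : orthonormal T w).

Let A k v : R := `|chain_dx u del k v| + `|chain_dy w del k v|.

(** The squares (|a| + |b|)^2 and (X_{k-1} - X_k)^2 are split with factors 2; Bessel then gives at
    most 8 |x|^2 + 2 |y|^2 <= 9 |v|^2, whence the 3, whatever the number of links. *)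
Let A_sum v : \sum_(k < T) A k v ^+ 2 <= (3 * enorm v / del) ^+ 2.
Proof.
pose X k := dotp (u k) (lsubmx v) ^+ 2; pose Y k := dotp (w k) (rsubmx v) ^+ 2.
pose X' k := if k is k'.+1 then X k' else 0.
have AE k : A k v ^+ 2 <= (4 * X k + 4 * X' k + 2 * Y k) / del ^+ 2.
  rewrite /A /chain_dx /chain_dy !normrM -mulrDl exprMn.
  rewrite (ger0_norm (x := del^-1)) ?invr_ge0 ?(ltW del0)// exprVn ler_pM2r ?invr_gt0 ?exprn_gt0//.
  set a := (_ - dotp (u k) _); set b := dotp (w k) _.
  have h1 : (`|a| + `|b|) ^+ 2 <= 2 * a ^+ 2 + 2 * b ^+ 2.
    rewrite -(real_normK (num_real a)) -(real_normK (num_real b)).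
    by have := sqr_ge0 (`|a| - `|b|); rewrite sqrrB sqrrD; lra.
  apply: le_trans h1 _; rewrite -/b lerD2r.
  have h2 (r s : R) : 2 * (r - s) ^+ 2 <= 4 * s ^+ 2 + 4 * r ^+ 2.
    by have := sqr_ge0 (r + s); rewrite sqrrB sqrrD; lra.
  rewrite /a /X' /X; case: (k : nat) => [|k']; last exact: h2.
  by have := h2 0 (dotp (u 0) (lsubmx v)); rewrite expr0n.
apply: (@le_trans _ _ (\sum_(k < T) (4 * X k + 4 * X' k + 2 * Y k) / del ^+ 2)).
  by apply: ler_sum => k _; exact: AE.
rewrite -mulr_suml !big_split/= -!mulr_sumr.
rewrite exprMn exprVn ler_pM2r ?invr_gt0 ?exprn_gt0//.
have bX : \sum_(k < T) X k <= dotp (lsubmx v) (lsubmx v) by exact: bessel.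
have bY : \sum_(k < T) Y k <= dotp (rsubmx v) (rsubmx v) by exact: bessel.
have bX' : \sum_(k < T) X' k <= \sum_(k < T) X k.
  case: (T) => [|T']; first by rewrite !big_ord0.
  by rewrite big_ord_recl add0r big_ord_recr/= lerDl sqr_ge0.
have ev : dotp v v = dotp (lsubmx v) (lsubmx v) + dotp (rsubmx v) (rsubmx v).
  by rewrite -[in LHS](hsubmxK v) dotp_row_mx.
rewrite exprMn enorm_sqr ev.
have := dotp_ge0 (lsubmx v); have := dotp_ge0 (rsubmx v); lra.
Qed.

Let A_le k v : (k < T)%N -> A k v <= 3 * enorm v / del.
Proof.
move=> kT; rewrite -ler_sqr ?nnegrE ?addr_ge0 ?divr_ge0 ?mulr_ge0 ?enorm_ge0 ?(ltW del0)//.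
apply: le_trans _ (A_sum v); rewrite (bigD1 (Ordinal kT))//= lerDl.
by apply: sumr_ge0 => i _; exact: sqr_ge0.
Qed.

Let A_dotp v v' : \sum_(k < T) A k v * A k v' <= (3 * enorm v / del) * (3 * enorm v' / del).
Proof.
pose a v : 'rV[R]_T := \row_k A k v.
have aE t : enorm (a t) <= 3 * enorm t / del.
  rewrite enorm_le ?divr_ge0 ?mulr_ge0 ?enorm_ge0 ?(ltW del0)//.
  by apply: le_trans _ (A_sum t); apply: ler_sum => k _; rewrite mxE -expr2.
rewrite (_ : \sum_(k < T) _ = dotp (a v) (a v')); last first.
  by apply: eq_bigr => k _; rewrite !mxE.
by apply: le_trans (dotp_le _ _) _; rewrite ler_pM ?enorm_ge0.
Qed.

(** A link contributes a product of p + 1 factors A, one for z - z' and one for each direction. The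
    first two are summed over the links by Cauchy-Schwarz ([A_dotp]), the other p - 1 are bounded
    uniformly by [A_le], so T does not enter the constant. *)
Lemma chain_lip p L K : (0 < p)%N -> 0 <= c -> 0 <= K ->
  (forall i j s t s' t', (i + j = p)%N ->
    `|coupling i j s t - coupling i j s' t'| <= K * (`|s - s'| + `|t - t'|)) ->
  c * (K * (3 / del) ^+ p.+1) <= L ->
  lip_D p L setT (chain u w M del c T).
Proof.
move=> p0 c0 K0 HK cL z z' _ _.
apply: ge_ereal_sup => _ [v /= v1 <-]; rewrite lee_fin.
apply: (@le_trans _ _ (c * (K * (3 / del) ^+ p.+1) * enorm (z - z'))); last first.
  by rewrite ler_wpM2r ?enorm_ge0.
rewrite !chain_Dform -mulrBr -sumrB normrM (ger0_norm c0) -mulrA ler_wpM2l//.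
apply: le_trans (ler_norm_sum _ _ _) _.
have d3 : 0 <= 3 / del by rewrite divr_ge0 ?(ltW del0).
have [v0 [vs ev vs1]] : exists v0, exists2 vs, tval v = v0 :: vs &
    size vs = p.-1 /\ forall x : 'rV[R]_(d + d), x \in v0 :: vs -> enorm x <= 1.
  have : size v = p by rewrite size_tuple.
  have : forall x : 'rV[R]_(d + d), x \in tval v -> enorm x <= 1.
    by move=> x /tnthP[i ->].
  case: (tval v) => [_ e|v0 vs H e]; first by rewrite -e in p0.
  by exists v0, vs => //; split=> //; rewrite -e.
have {vs1}[svs vs1] := vs1.
apply: (@le_trans _ _ (\sum_(k < T) K * (3 / del) ^+ p.-1 * (A k (z - z') * A k v0))).
  apply: ler_sum => k _.
  have := @mixed_lip R coupling
    [seq (chain_dx u del k v, chain_dy w del k v) | v <- v] (K * A k (z - z')) 0 0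
    (chain_x u M del k z) (chain_dy w del k z) (chain_x u M del k z') (chain_dy w del k z').
  rewrite size_map size_tuple !add0n => /(_ _ _)/le_trans; apply.
  - by rewrite mulr_ge0// addr_ge0.
  - move=> i j ij; apply: le_trans (HK _ _ _ _ _ _ ij) _.
    rewrite ler_wpM2l// /A chain_dxB chain_dyB lerD2r le_eqVlt; apply/orP; left.
    by apply/eqP; congr `|_|; rewrite /chain_x; ring.
  rewrite big_map ev big_cons/= -/(A k v0); set P := \prod_(_ <- _) _.
  have HP : P <= (3 / del) ^+ p.-1.
    have : forall x : 'rV[R]_(d + d), x \in vs -> enorm x <= 1.
      by move=> x xvs; apply: vs1; rewrite inE xvs orbT.
    rewrite /P -svs; elim: (vs) => [|x s IH] H; first by rewrite big_nil expr0.
    rewrite big_cons exprS ler_pM ?addr_ge0//.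
    - by apply: prodr_ge0 => i _; rewrite addr_ge0.
    - apply: le_trans (A_le x (ltn_ord k)) _; rewrite mulrAC ger_pMr ?divr_gt0//.
      by apply: H; rewrite mem_head.
    - by apply: IH => t ts; apply: H; rewrite inE ts orbT.
  have A0 t : 0 <= A k t by rewrite addr_ge0.
  rewrite [leLHS](_ : _ = K * A k (z - z') * A k v0 * P); last by rewrite !mulrA.
  rewrite [leRHS](_ : _ = K * A k (z - z') * A k v0 * (3 / del) ^+ p.-1); last by ring.
  by rewrite ler_wpM2l// !mulr_ge0.
rewrite -mulr_sumr -[leRHS]mulrA -[leLHS]mulrA ler_wpM2l//.
rewrite (_ : (3 / del) ^+ p.+1 = (3 / del) ^+ p.-1 * ((3 / del) * (3 / del))); last first.
  by rewrite -expr2 -exprD addn2 prednK.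
rewrite -[leRHS]mulrA ler_wpM2l ?exprn_ge0//.
apply: le_trans (A_dotp _ _) _.
have v01 : enorm v0 <= 1 by apply: vs1; rewrite mem_head.
rewrite [leLHS](_ : _ = (3 / del * (3 / del) * enorm (z - z')) * enorm v0); last by ring.
by apply: ler_piMr v01; rewrite !mulr_ge0 ?enorm_ge0 ?invr_ge0 ?(ltW del0).
Qed.

End Smoothness.

Lemma chain_x_aff u M del k x x' y (t : R) :
  chain_x u M del k (row_mx (t *: x + (1 - t) *: x') y) =
  t * chain_x u M del k (row_mx x y) + (1 - t) * chain_x u M del k (row_mx x' y).
Proof.
rewrite /chain_x /chain_dx !row_mxKl; case: k => [|k].
  by rewrite !(dotpDr, dotpZr); ring.
by rewrite !(dotpDr, dotpZr); ring.
Qed.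

Lemma chain_y_aff w del k x y y' (t : R) :
  chain_dy w del k (row_mx x (t *: y + (1 - t) *: y')) =
  t * chain_dy w del k (row_mx x y) + (1 - t) * chain_dy w del k (row_mx x y').
Proof. by rewrite /chain_dy !row_mxKr !(dotpDr, dotpZr); ring. Qed.

Lemma chain_xr u M del k x y y' :
  chain_x u M del k (row_mx x y) = chain_x u M del k (row_mx x y').
Proof. by rewrite /chain_x /chain_dx !row_mxKl. Qed.

Lemma chain_yl w del k x x' y :
  chain_dy w del k (row_mx x y) = chain_dy w del k (row_mx x' y).
Proof. by rewrite /chain_dy !row_mxKr. Qed.

Lemma chain_convex_concave u w M del c T : 0 <= c ->
  convex_concave setT setT (chain u w M del c T).
Proof.
move=> c0; split=> [y _|x _] t a b _ _.
  rewrite /conv/= /chain.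
  rewrite [leRHS](_ : _ = c * (t%:num * (\sum_(k < T) coupling 0 0
      (chain_x u M del k (row_mx a y)) (chain_dy w del k (row_mx a y))) +
    (1 - t%:num) * (\sum_(k < T) coupling 0 0
      (chain_x u M del k (row_mx b y)) (chain_dy w del k (row_mx b y))))); last first.
    by rewrite /conv/= /GRing.scale/= /unstable.onem; ring.
  rewrite ler_wpM2l// !mulr_sumr -big_split/=; apply: ler_sum => k _.
  (* The second argument ignores x; putting 0 there makes it literally the same t in all three
     couplings. *)
  rewrite chain_x_aff !(chain_yl _ _ _ _ 0); exact: coupling_convexl.
rewrite /conv/= /chain.
rewrite [leRHS](_ : _ = - (c * (t%:num * (\sum_(k < T) coupling 0 0
      (chain_x u M del k (row_mx x a)) (chain_dy w del k (row_mx x a))) +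
    (1 - t%:num) * (\sum_(k < T) coupling 0 0
      (chain_x u M del k (row_mx x b)) (chain_dy w del k (row_mx x b)))))); last first.
  by rewrite /conv/= /GRing.scale/= /unstable.onem; ring.
rewrite lerN2 ler_wpM2l// !mulr_sumr -big_split/=; apply: ler_sum => k _.
rewrite chain_y_aff !(chain_xr _ _ _ _ _ _ 0); exact: coupling_concaver.
Qed.

Section Gap.
Variables (u w : nat -> 'rV[R]_d) (M del c : R) (T : nat).
Hypotheses (del0 : 0 < del) (c0 : 0 <= c).
Hypotheses (ou : orthonormal T.+1 u) (ow : orthonormal T.+1 w).
Hypothesis (MT : M = del * (8 * T.+1%:R + 2)).

Let x' := \sum_(i < T.+1) M *: u i.
Let y' := \sum_(i < T.+1) M *: w i.

Lemma chain_x_sum k z : \sum_(i < k.+1) chain_x u M del i z =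
  (M - dotp (u k) (lsubmx z)) / del.
Proof.
elim: k => [|k IH]; rewrite big_ord_recr/=.
  by rewrite big_ord0 /chain_x /chain_dx/=; ring.
by rewrite IH /chain_x /chain_dx/=; ring.
Qed.

Lemma chain_witness_norm : dotp x' x' = M ^+ 2 * T.+1%:R /\ dotp y' y' = M ^+ 2 * T.+1%:R.
Proof.
rewrite /x' /y' !(sqr_orthonormal_sum (fun=> M))//.
by rewrite sumr_const card_ord mulr_natr.
Qed.

(** Write m = M / del. At y' every second argument is m, and the first arguments sum to at least m -
    1/2 by telescoping. [coupling_ge] loses 2 m + 4 per link, and m = 8 (T + 1) + 2 is large enough
    for half of m^2 to survive. *)
Lemma chain_witness x y : `|dotp (u T) x| <= del / 2 ->
  c * ((8 * T.+1%:R + 2) ^+ 2 / 2) <=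
  chain u w M del c T.+1 (row_mx x y') - chain u w M del c T.+1 (row_mx x' y).
Proof.
move=> xT; rewrite /chain -mulrBr ler_wpM2l//.
set m := 8 * T.+1%:R + 2.
have T0 : 1 <= T.+1%:R :> R by rewrite ler1n.
have h1 : \sum_(k < T.+1) coupling 0 0 (chain_x u M del k (row_mx x' y))
    (chain_dy w del k (row_mx x' y)) <= 0.
  apply: sumr_le0 => k _.
  rewrite (_ : chain_x _ _ _ _ _ = 0) ?coupling0_le0//.
  rewrite /chain_x /chain_dx row_mxKl.
  case: k => [[|k]] kT /=; rewrite !(dotp_orthonormal_sum (fun=> M))//.
    by ring.
  by rewrite subrr mul0r mul0r addr0.
  exact: ltnW.
have Mm : M / del = m by rewrite MT -/m mulrC mulKf ?gt_eqF.
have h2 k : (k < T.+1)%N -> chain_dy w del k (row_mx x y') = m.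
  by move=> kT; rewrite /chain_dy row_mxKr (dotp_orthonormal_sum (fun=> M)).
have h3 : \sum_(k < T.+1) (chain_x u M del k (row_mx x y') * m - 2 * m - 4) <=
  \sum_(k < T.+1) coupling 0 0 (chain_x u M del k (row_mx x y'))
    (chain_dy w del k (row_mx x y')).
  apply: ler_sum => k _; rewrite h2//; apply: coupling_ge.
  by rewrite /m addr_ge0// mulr_ge0.
move: h3; set S1 := (X in _ <= X) => h3.
rewrite !sumrB -mulr_suml chain_x_sum row_mxKl !sumr_const card_ord in h3.
rewrite -(mulr_natr (2 * m)) -(mulr_natr 4 T.+1) in h3.
have h4 : m - 2^-1 <= (M - dotp (u T) x) / del.
  rewrite mulrBl Mm lerB// ler_pdivrMr// mulrC.
  by rewrite (le_trans (ler_norm _)).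
have m0 : 0 <= m by rewrite /m; lra.
have h5 := ler_wpM2r m0 h4.
suff : m ^+ 2 / 2 <= (m - 2^-1) * m - 2 * m * T.+1%:R - 4 * T.+1%:R.
  move=> h6; apply: le_trans h6 _; apply: (@le_trans _ _ S1).
    by apply: le_trans h3; rewrite 2!lerD2r.
  by rewrite lerDl oppr_ge0.
have -> : m = 8 * T.+1%:R + 2 by [].
move: T0; set t := T.+1%:R => t1.
rewrite -subr_ge0 [leRHS](_ : _ = 16 * t ^+ 2 + 4 * t + 1); last by field.
by rewrite !addr_ge0// mulr_ge0 ?sqr_ge0// ltW// (lt_le_trans ltr01).
Qed.

End Gap.

End Chain.

(** * Balls, gap and tangent residual *)

Section Continuity.
Context {R : realType} {T : topologicalType}.

Lemma continuous_sum (V : normedModType R) (I : Type) (r : seq I) (F : I -> T -> V) :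
  (forall i, continuous (F i)) -> continuous (fun t => \sum_(i <- r) F i t).
Proof.
move=> cF; elim: r => [|i r IH].
  by under eq_fun do rewrite big_nil; move=> t; exact: cvg_cst.
under eq_fun do rewrite big_cons.
by move=> t; apply: continuousD; [exact: cF | exact: IH].
Qed.

Lemma continuous_rV n (f : T -> 'rV[R]_n) :
  (forall i, continuous (fun t => f t 0 i : R)) -> continuous f.
Proof.
move=> cf; have -> : f = fun t => \sum_i f t 0 i *: delta_mx 0 i.
  by apply/funext => t; exact: row_sum_delta.
by apply: continuous_sum => i t; apply: continuousZr_tmp; exact: cf.
Qed.

Lemma continuous_row_mx n m (f : T -> 'rV[R]_n) (g : T -> 'rV[R]_m) :
  (forall i, continuous (fun t => f t 0 i : R)) ->
  (forall i, continuous (fun t => g t 0 i : R)) ->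
  continuous (fun t => row_mx (f t) (g t)).
Proof.
move=> cf cg; apply: continuous_rV => i.
by under eq_fun do rewrite mxE; case: split_ordP => j _; [exact: cf|exact: cg].
Qed.

Lemma continuous_dotp n (f g : T -> 'rV[R]_n) :
  (forall i, continuous (fun t => f t 0 i : R)) ->
  (forall i, continuous (fun t => g t 0 i : R)) ->
  continuous (fun t => dotp (f t) (g t)).
Proof.
move=> cf cg; apply: continuous_sum => i t.
by apply: continuousM; [exact: cf | exact: cg].
Qed.

Lemma continuous_enorm n (f : T -> 'rV[R]_n) :
  (forall i, continuous (fun t => f t 0 i : R)) -> continuous (fun t => enorm (f t)).
Proof.
move=> cf t; apply: (@continuous_comp _ _ _ (fun t => dotp (f t) (f t)) Num.sqrt).
  exact: continuous_dotp.
exact: sqrt_continuous.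
Qed.

Lemma closed_le_fun (f : T -> R) c : continuous f -> closed [set t | f t <= c].
Proof.
move=> cf; apply: (@closed_comp _ _ f [set x | x <= c]); last exact: closed_le.
by move=> t _; exact: cf.
Qed.

End Continuity.

Section BallDomain.
Context {R : realType}.

Lemma eball0E n r : eball (0 : 'rV[R]_n) r = [set x | enorm x <= r].
Proof. by apply/funext => x; rewrite /eball/= subr0. Qed.

Lemma eball_compact n r : compact (eball (0 : 'rV[R]_n) r).
Proof.
apply: bounded_closed_compact.
  exists r; split; first exact: num_real.
  move=> s rs x; rewrite eball0E /= => xr.
  rewrite [leLHS]/Num.Def.normr/= mx_normrE; apply/bigmax_leP; split.
    by apply: ltW; apply: le_lt_trans rs; apply: le_trans xr; exact: enorm_ge0.
  move=> [i j] _ /=; rewrite (ord1 i); apply: le_trans (le_coord_enorm _ _) _.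
  exact: ltW (le_lt_trans xr rs).
rewrite eball0E; apply: closed_le_fun; apply: continuous_enorm => i.
exact: coord_continuous.
Qed.

Lemma eball_convex n r : convex_set (eball (0 : 'rV[R]_n) r).
Proof.
move=> x y t; rewrite eball0E !inE /= => xr yr.
rewrite /conv/= (le_trans (enormD _ _))// !enormZ !ger0_norm//; last by rewrite subr_ge0.
apply: le_trans (lerD (ler_wpM2l _ xr) (ler_wpM2l _ yr)) _ => //; first by rewrite subr_ge0.
by rewrite -mulrDl /unstable.onem addrC subrK mul1r.
Qed.

Lemma eball_nonempty n r : 0 <= r -> eball (0 : 'rV[R]_n) r !=set0.
Proof. by move=> r0; exists 0; rewrite eball0E /= enorm0. Qed.

Definition ball_domain d (r : R) (r0 : 0 <= r) : domain R :=
  @Domain R d d (eball 0 r) (eball 0 r) (@eball_nonempty d r r0) (@eball_nonempty d r r0)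
    (@eball_compact d r) (@eball_compact d r) (@eball_convex d r) (@eball_convex d r).

(** Each factor contributes at most (2 r)^2 to the squared distance; the sum 8 r^2 is the origin of
    sqrt 8 in [radius]. *)
Lemma ball_prod_diam d (r D : R) (u v : 'rV[R]_(d + d)) : 0 <= r -> 0 <= D ->
  8 * r ^+ 2 = D ^+ 2 ->
  prodset (eball 0 r) (eball 0 r) u -> prodset (eball 0 r) (eball 0 r) v ->
  enorm (u - v) <= D.
Proof.
move=> r0 D0 rD [ux uy] [vx vy]; rewrite !eball0E /= in ux uy vx vy.
rewrite enorm_le// -rD -(hsubmxK u) -(hsubmxK v).
rewrite opp_row_mx add_row_mx dotp_row_mx -!enorm_sqr.
have h a b : enorm a <= r -> enorm b <= r -> enorm (a - b : 'rV[R]_d) ^+ 2 <= (2 * r) ^+ 2.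
  move=> ar br; rewrite ler_sqr ?nnegrE ?enorm_ge0 ?mulr_ge0//.
  by rewrite (le_trans (enormB _ _))// mulr_natl mulr2n lerD.
by have := h _ _ ux vx; have := h _ _ uy vy; rewrite exprMn; lra.
Qed.

Lemma diam_ball d (r D : R) : (0 < d)%N -> 0 <= r -> 0 <= D -> 8 * r ^+ 2 = D ^+ 2 ->
  diam (prodset (eball (0 : 'rV[R]_d) r) (eball (0 : 'rV[R]_d) r)) = D%:E.
Proof.
case: d => // d _ r0 D0 rD; apply/eqP; rewrite eq_le; apply/andP; split.
  apply: ge_ereal_sup => _ [u Zu [v Zv <-]].
  by rewrite lee_fin (ball_prod_diam r0 D0 rD).
apply: ereal_sup_ubound => /=.
pose e : 'rV[R]_d.+1 := r *: delta_mx 0 0.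
have e1 : dotp e e = r ^+ 2.
  by rewrite dotpZl dotpZr dotp_delta mxE !eqxx mulr1 expr2.
have er : enorm e <= r by rewrite enorm_le// e1.
exists (row_mx e e); first by rewrite /prodset /= row_mxKl row_mxKr eball0E.
exists (- row_mx e e).
  by rewrite opp_row_mx /prodset /= row_mxKl row_mxKr eball0E /= enormN.
congr (_%:E); rewrite opprK -mulr2n -scaler_nat enormZ ger0_norm//.
rewrite /enorm dotp_row_mx e1.
apply: (@pexpIrn _ 2) => //; rewrite ?nnegrE ?mulr_ge0 ?sqrtr_ge0//.
rewrite exprMn sqr_sqrtr; last by rewrite addr_ge0// sqr_ge0.
by rewrite -rD; ring.
Qed.

End BallDomain.

Section SaddleBounds.
Context {R : realType} {dx dy : nat}.
Variables (X : set 'rV[R]_dx) (Y : set 'rV[R]_dy) (phi : 'rV[R]_(dx + dy) -> R).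

(** [sup] and [inf] bound the values only for bounded sets; boundedness comes from extreme values on
    the compact sets. *)
Lemma gap_ge z x' y' : compact X -> compact Y -> continuous phi ->
  X x' -> Y y' ->
  phi (row_mx (lsubmx z) y') - phi (row_mx x' (rsubmx z)) <= gap X Y phi z.
Proof.
move=> cX cY cphi Xx Yy; rewrite /gap lerB//.
  have cf : continuous (fun y => phi (row_mx (lsubmx z) y)).
    move=> y; apply: continuous_comp; last exact: cphi.
    by apply: continuous_row_mx => i t; [exact: cst_continuous | exact: coord_continuous].
  have [|c _ Hc] := @compact_EVT_max _ _ _ Y _ cY (continuous_subspaceT cf).
    by exists y'.
  apply: ub_le_sup; last by exists y'.
  by exists (phi (row_mx (lsubmx z) c)) => _ [y Y1 <-]; apply: Hc; rewrite inE.
have cf : continuous (fun x => phi (row_mx x (rsubmx z))).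
  move=> x; apply: continuous_comp; last exact: cphi.
  by apply: continuous_row_mx => i t; [exact: coord_continuous | exact: cst_continuous].
have [|c _ Hc] := @compact_EVT_min _ _ _ X _ cX (continuous_subspaceT cf).
  by exists x'.
apply: ge_inf; last by exists x'.
by exists (phi (row_mx c (rsubmx z))) => _ [y Y1 <-]; apply: Hc; rewrite inE.
Qed.

Lemma derive_le_convex n (f : 'rV[R]_n -> R) (h z : 'rV[R]_n) : derivable f z h ->
  (forall t, 0 <= t -> t <= 1 -> f (t *: h + z) <= t * f (h + z) + (1 - t) * f z) ->
  'D_h f z <= f (h + z) - f z.
Proof.
move=> dphi H; rewrite /derive cvg_at_rightE//.
apply: limr_le; first by apply: cvgP; apply: cvg_dnbhs_at_right; exact: dphi.
near=> t; have t0 : 0 < t by near: t; exact: nbhs_right_gt.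
have t1 : t <= 1 by near: t; apply: nbhs_right_le; exact: ltr01.
rewrite /= /GRing.scale/= mulrC ler_pdivrMr// lerBlDr.
by apply: le_trans (H t (ltW t0) t1) _; rewrite le_eqVlt; apply/orP; left; apply/eqP; ring.
Unshelve. all: by end_near. Qed.

Lemma gradient_dotp z v : differentiable phi z -> dotp (gradient phi z) v = 'D_v phi z.
Proof.
move=> d; rewrite deriveE// [in RHS](row_sum_delta v) linear_sum/=.
by apply: eq_bigr => i _; rewrite linearZ/= -deriveE// mxE mulrC.
Qed.

(** Sum of two first-order convexity inequalities at z, for phi towards x' and for -phi towards y';
    the value phi(z) cancels. *)
Lemma saddle_op_ge z x' y' : differentiable phi z -> convex_concave setT setT phi ->
  phi (row_mx (lsubmx z) y') - phi (row_mx x' (rsubmx z)) <=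
  dotp (saddle_op phi z) (z - row_mx x' y').
Proof.
move=> dphi [cx cy].
set x := lsubmx z; set y := rsubmx z; pose hx := row_mx (x' - x) 0 : 'rV[R]_(dx + dy).
pose hy := row_mx 0 (y' - y) : 'rV[R]_(dx + dy).
have ex t : t *: hx + z = row_mx (t *: x' + (1 - t) *: x) y.
  rewrite -{1}(hsubmxK z) scale_row_mx add_row_mx scaler0 add0r; congr row_mx.
  by rewrite scalerBr scalerBl scale1r -addrA (addrC (- _)).
have ey t : t *: hy + z = row_mx x (t *: y' + (1 - t) *: y).
  rewrite -{1}(hsubmxK z) scale_row_mx add_row_mx scaler0 add0r; congr row_mx.
  by rewrite scalerBr scalerBl scale1r -addrA (addrC (- _)).
have ez : z = row_mx x y by rewrite hsubmxK.
have ex1 : hx + z = row_mx x' y by have := ex 1; rewrite !scale1r subrr scale0r addr0.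
have ey1 : hy + z = row_mx x y' by have := ey 1; rewrite !scale1r subrr scale0r addr0.
have Hx : 'D_hx phi z <= phi (hx + z) - phi z.
  apply: derive_le_convex; first exact: diff_derivable.
  move=> t t0 t1; rewrite ex ex1 {1}ez.
  by apply: (cx y I (Itv01 t0 t1) x' x); rewrite inE.
have Hy : 'D_hy (- phi) z <= (- phi) (hy + z) - (- phi) z.
  apply: derive_le_convex; first by apply: derivableN; exact: diff_derivable.
  move=> t t0 t1; rewrite ey ey1 {1}ez.
  by apply: (cy x I (Itv01 t0 t1) y' y); rewrite inE.
rewrite deriveN in Hy; last exact: diff_derivable.
rewrite -!gradient_dotp// ex1 ey1 -{1}(hsubmxK (gradient phi z)) in Hx Hy.
rewrite -{1}(hsubmxK (gradient phi z)) in Hy.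
rewrite !dotp_row_mx !dotp0r addr0 add0r in Hx Hy.
rewrite {2}ez /saddle_op opp_row_mx add_row_mx dotp_row_mx dotpNl.
rewrite -(opprB x') -(opprB y') !dotpNr opprK.
have eN w : (- phi) w = - phi w by [].
by rewrite !eN in Hy; lra.
Qed.

(** A normal vector v has nonnegative product with z - (x', y'), so adding it to the operator can
    only raise the product in [saddle_op_ge]; Cauchy-Schwarz then divides by D. *)
Lemma tan_residual_ge z x' y' D : 0 < D -> differentiable phi z ->
  convex_concave setT setT phi -> X x' -> Y y' -> X (lsubmx z) -> Y (rsubmx z) ->
  enorm (z - row_mx x' y') <= D ->
  (phi (row_mx (lsubmx z) y') - phi (row_mx x' (rsubmx z))) / D <= tan_residual X Y phi z.
Proof.
move=> D0 dphi ccphi Xx Yy Xz Yz zD; apply: lb_le_inf.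
  exists (enorm (saddle_op phi z + 0)), 0 => //.
  by move=> z' _; rewrite dotp0l.
move=> _ [v vN <-]; rewrite ler_pdivrMr//.
apply: le_trans (saddle_op_ge _ _ dphi ccphi) _.
have h : dotp v (row_mx x' y' - z) <= 0.
  by apply: vN; rewrite /prodset/= row_mxKl row_mxKr.
apply: (@le_trans _ _ (dotp (saddle_op phi z + v) (z - row_mx x' y'))).
  by rewrite dotpDl lerDl -opprB dotpNr oppr_ge0.
by apply: le_trans (dotp_le _ _) _; rewrite ler_wpM2l// enorm_ge0.
Qed.

End SaddleBounds.

(** * Resisting deterministic algorithms *)

Section Greedy.
Context {R : realType} {d : nat}.
Implicit Types (u w : nat -> 'rV[R]_d).

Definition upd u k a : nat -> 'rV[R]_d := fun i => if i == k then a else u i.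

Lemma upd_lt u k a i : (i < k)%N -> upd u k a i = u i.
Proof. by move=> ik; rewrite /upd ltn_eqF. Qed.

Lemma orthonormal_upd u k a : orthonormal k u -> dotp a a = 1 ->
  (forall i, (i < k)%N -> dotp a (u i) = 0) -> orthonormal k.+1 (upd u k a).
Proof.
move=> ou a1 au i j; rewrite !ltnS leq_eqVlt (leq_eqVlt j) /upd.
move=> /predU1P[->|ik] /predU1P[->|jk]; rewrite ?eqxx //.
- by rewrite (ltn_eqF jk) au// (gtn_eqF jk).
- by rewrite (ltn_eqF ik) dotpC au.
- by rewrite (ltn_eqF ik) (ltn_eqF jk) ou.
Qed.

(** Shared by the deterministic and the randomized construction: the requirement Q k involves only
    links 0 to k, so later choices cannot spoil it. *)
Lemma greedy_frames (Q : nat -> (nat -> 'rV[R]_d) -> (nat -> 'rV[R]_d) -> Prop) T :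
  (forall k u w u' w', (forall i, (i <= k)%N -> u i = u' i /\ w i = w' i) ->
    Q k u w -> Q k u' w') ->
  (forall k u w, (k < T)%N -> orthonormal k u -> orthonormal k w ->
    exists a b, [/\ orthonormal k.+1 (upd u k a), orthonormal k.+1 (upd w k b) &
                    Q k (upd u k a) (upd w k b)]) ->
  exists u w, [/\ orthonormal T u, orthonormal T w & forall k, (k < T)%N -> Q k u w].
Proof.
move=> Qext step; elim: T step => [|T IH] step; first by exists (fun=> 0), (fun=> 0).
have [|u [w [ou ow H]]] := IH; first by move=> k u w kT; apply: step; rewrite ltnW.
have [a [b [oa ob Qab]]] := step T u w (ltnSn T) ou ow.
exists (upd u T a), (upd w T b); split=> // k; rewrite ltnS leq_eqVlt.
move=> /predU1P[->//|kT]; apply: Qext (H k kT) => i ik.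
by rewrite !upd_lt// (leq_ltn_trans ik).
Qed.

End Greedy.

Section Run.
Context {R : realType} {d : nat} (r : R) (r0 : 0 <= r) (p N : nat).
Implicit Types (u w : nat -> 'rV[R]_d) (A : policy p N (ball_domain d r0)).
Variables (M del c : R).

Lemma chain_eq u w u' w' k : (forall i, (i < k)%N -> u i = u' i /\ w i = w' i) ->
  chain u w M del c k = chain u' w' M del c k.
Proof.
move=> H; apply/funext => z; rewrite /chain; congr (_ * _).
apply: eq_bigr => -[i ik] _ /=; have [e1 e2] := H i ik.
rewrite /chain_x /chain_dx /chain_dy e1 e2; case: i ik {e1 e2} => [//|i] ik.
by have [-> _] := H i (ltnW ik).
Qed.

(** Computed against the chain with t links, hence independent of the links from t on, which can
    still be chosen in view of it. Index N is the output. A query is defined on every history, so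
    one counts even if the policy has already stopped. *)
Definition point A u w t : 'rV[R]_(d + d) :=
  let h := transcript A (chain u w M del c t) t in
  if (t < N)%N then query A h else output A h.

Lemma point_eq A u w u' w' t : (forall i, (i < t)%N -> u i = u' i /\ w i = w' i) ->
  point A u w t = point A u' w' t.
Proof. by move=> H; rewrite /point (chain_eq H). Qed.

Lemma point_feasible A u w t : setz (ball_domain d r0) (point A u w t).
Proof. by rewrite /point; case: ifP => _; [exact: query_feasible|exact: output_feasible]. Qed.

(* Each query of the run against the full chain only sees the links already
   revealed, so the run is the one against the truncated chains. *)
Lemma result_chain A u w : 0 < del ->
  (forall t i, (t <= i <= N)%N -> `|dotp (u i) (lsubmx (point A u w t))| <= del / 2 /\
    `|dotp (w i) (rsubmx (point A u w t))| <= del / 2) ->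
  result A (chain u w M del c N.+1) = point A u w N.
Proof.
move=> del0 H.
have main t k : (t <= N)%N -> (t <= k <= N.+1)%N ->
    transcript A (chain u w M del c k) t = transcript A (chain u w M del c t) t.
  elim: t k => [//|t IH] k tN /andP[tk kN].
  rewrite /= !IH ?(ltnW tN) ?(ltnW tk) ?leqnSn//; last by rewrite (leq_trans tN).
  set h := transcript A _ t; case: ifP => // _; congr (rcons h (_, _)).
  have qt : query A h = point A u w t by rewrite /point tN.
  apply/ffunP => a; rewrite !ffunE; apply: chain_Dform_flat => // i /andP[ti ik].
  have iN : (i <= N)%N by rewrite -ltnS (leq_trans ik).
  have [|x1 y1] := H t i; first by rewrite iN andbT ltnW.
  (* Query t may see link t, whose first argument involves X_{t-1}. Links from t + 1 on involve only
     X_i with i >= t, so two bounds del / 2 add up to del. *)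
  case: i ti ik iN x1 y1 => // i; rewrite ltnS => ti ik iN x1 y1.
  have [|x2 _] := H t i; first by rewrite ti ltnW.
  rewrite qt /chain_x /chain_dx /chain_dy /= mul0r addr0.
  split; rewrite normrM normfV (gtr0_norm del0) ler_pdivrMr// mul1r.
    by rewrite (le_trans (ler_normB _ _))// (le_trans (lerD x2 x1))// -splitr.
  by apply: le_trans y1 _; rewrite ler_pdivrMr// mulr_natr mulr2n lerDl ltW.
by rewrite /result main ?leqnn ?leqnSn// /point ltnn.
Qed.

End Run.

(** * Scaling of the hard function and the deterministic lower bound *)

Section Instance.
Context {R : realType}.
Variables (p N : nat) (L D K : R).
Hypotheses (p2 : (2 <= p)%N) (L0 : 0 < L) (D0 : 0 < D) (K0 : 0 <= K).
Hypothesis HK : forall i j (s t s' t' : R), (i + j = p)%N ->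
  `|coupling i j s t - coupling i j s' t'| <= K * (`|s - s'| + `|t - t'|).

Definition radius : R := D / Num.sqrt 8.
(* The amplitude is radius / sqrt (N+1), so that the N+1 orthogonal steps of
   the test points stay in the ball; it is cut into levels of width gapwidth. *)
Definition levels : R := 8 * N.+1%:R + 2.
Definition amplitude : R := radius / Num.sqrt N.+1%:R.
Definition gapwidth : R := amplitude / levels.
(** Makes the bound of [chain_lip] equal to L K / (K + 1), which is at most L; the denominator K + 1
    is positive even when K = 0. *)
Definition coefficient : R := L * (gapwidth / 3) ^+ p.+1 / (K + 1).
(** The powers of sqrt 8 come from [radius], those of 10 from [levels] <= 10 (N + 1), those of 3 and
    K + 1 from [coefficient], and the 2 from [chain_witness]. *)
Definition rate_constant : R :=
  (Num.sqrt 8 ^+ p.+1 * 10 ^+ p.-1 * 3 ^+ p.+1 * 2 * (K + 1))^-1.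

Lemma radius_gt0 : 0 < radius. Proof. by rewrite divr_gt0// sqrtr_gt0. Qed.
Lemma radius_ge0 : 0 <= radius. Proof. exact: ltW radius_gt0. Qed.

Lemma radiusE : 8 * radius ^+ 2 = D ^+ 2.
Proof. by rewrite /radius exprMn exprVn sqr_sqrtr// mulrCA mulfV ?mulr1. Qed.

Lemma levels_gt0 : 0 < levels. Proof. by rewrite addr_gt0// mulr_gt0// ltr0n. Qed.

Lemma amplitude_gt0 : 0 < amplitude.
Proof. by rewrite divr_gt0 ?radius_gt0// sqrtr_gt0 ltr0n. Qed.

Lemma gapwidth_gt0 : 0 < gapwidth.
Proof. by rewrite divr_gt0 ?amplitude_gt0 ?levels_gt0. Qed.

Lemma coefficient_ge0 : 0 <= coefficient.
Proof.
rewrite divr_ge0 ?addr_ge0// mulr_ge0 ?(ltW L0)// exprn_ge0// divr_ge0//.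
exact: ltW gapwidth_gt0.
Qed.

Lemma rate_constant_gt0 : 0 < rate_constant.
Proof.
by rewrite invr_gt0 !mulr_gt0 ?exprn_gt0 ?sqrtr_gt0// ltr_wpDl.
Qed.

(** Splits (3p - 1)/2 as (p + 1)/2 + (p - 1): the first part is the loss in [amplitude], the second
    the loss in [levels], of whose p + 1 powers two are regained in the gap. *)
Lemma rateE : rate R p N = Num.sqrt N.+1%:R ^+ p.+1 * N.+1%:R ^+ p.-1.
Proof.
have e : (3 * p%:R - 1) = (3 * p - 1)%N%:R :> R.
  by rewrite natrB ?natrM// muln_gt0/= (ltn_trans _ p2).
rewrite /rate e mulrC powRrM powR12_sqrt// powR_mulrn ?sqrtr_ge0//.
rewrite -[in X in _ = _ * X](sqr_sqrtr (ler0n R N.+1)) -exprM -exprD; congr (_ ^+ _).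
by case: p p2 => // q _; lia.
Qed.

Lemma coefficient_ge :
  rate_constant * (L * D ^+ p.+1 / rate R p N) <= coefficient * (levels ^+ 2 / 2).
Proof.
have rge0 := radius_ge0.
have s0 : 0 < Num.sqrt N.+1%:R :> R by rewrite sqrtr_gt0 ltr0n.
have s8 : 0 < Num.sqrt 8 :> R by rewrite sqrtr_gt0.
have l0 := levels_gt0; have K1 : 0 < K + 1 by rewrite ltr_wpDl.
have n0 : 0 < N.+1%:R :> R by rewrite ltr0n.
have -> : D = radius * Num.sqrt 8 by rewrite /radius divfK// gt_eqF.
rewrite /rate_constant rateE /coefficient /gapwidth /amplitude.
set s := Num.sqrt N.+1%:R in s0 *; set e := Num.sqrt 8 in s8 *; set r := radius.
set l := levels in l0 *; set n := N.+1%:R in n0 *.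
have ln : l <= 10 * n.
  have n1 : 1 <= n by rewrite ler1n.
  by rewrite /l /levels -/n; lra.
rewrite [leLHS](_ : _ = L * r ^+ p.+1 / (3 ^+ p.+1 * 2 * (K + 1) * s ^+ p.+1) *
   ((10 * n) ^+ p.-1)^-1); last first.
  rewrite !exprMn; field.
  by rewrite !expf_neq0 ?gt_eqF.
rewrite [leRHS](_ : _ = L * r ^+ p.+1 / (3 ^+ p.+1 * 2 * (K + 1) * s ^+ p.+1) *
   (l ^+ p.-1)^-1); last first.
  have lE : l ^+ p.+1 = l ^+ p.-1 * l ^+ 2.
    by rewrite -exprD addn2 prednK// ltnW.
  rewrite !expr_div_n lE; field.
  by rewrite !expf_neq0 ?gt_eqF.
rewrite ler_wpM2l//.
  rewrite divr_ge0 ?mulr_ge0 ?exprn_ge0 ?(ltW L0) ?(ltW K1) ?(ltW s0)//.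
rewrite lef_pV2 ?posrE ?exprn_gt0 ?mulr_gt0//.
by rewrite lerXn2r ?nnegrE ?mulr_ge0// ltW.
Qed.

Section HardFunction.
Variables (d : nat) (u w : nat -> 'rV[R]_d).
Hypotheses (ou : orthonormal N.+1 u) (ow : orthonormal N.+1 w).

Let phi := chain u w amplitude gapwidth coefficient N.+1.
Let Z := prodset (eball (0 : 'rV[R]_d) radius) (eball (0 : 'rV[R]_d) radius).

Lemma hard_lip : lip_D p L setT phi.
Proof.
apply: chain_lip HK _ => //; [exact: gapwidth_gt0 | exact: ltnW | exact: coefficient_ge0 |].
have g0 := gapwidth_gt0; have K1 : 0 < K + 1 by rewrite ltr_wpDl.
rewrite /coefficient [leLHS](_ : _ = L * (K / (K + 1))).
  by rewrite ger_pMr// ler_pdivrMr// mul1r lerDl.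
move: g0; generalize gapwidth => g g0; rewrite !expr_div_n; field.
by rewrite !expf_neq0 ?gt_eqF.
Qed.

Lemma hard_gap_residual z : Z z -> `|dotp (u N) (lsubmx z)| <= gapwidth / 2 ->
  rate_constant * (L * D ^+ p / rate R p N) <=
    tan_residual (eball 0 radius) (eball 0 radius) phi z /\
  rate_constant * (L * D ^+ p.+1 / rate R p N) <=
    gap (eball 0 radius) (eball 0 radius) phi z.
Proof.
move=> Zz zN; have rge0 := radius_ge0; have g0 := gapwidth_gt0; have c0 := coefficient_ge0.
have ME : amplitude = gapwidth * (8 * N.+1%:R + 2).
  by rewrite /gapwidth divfK// gt_eqF// levels_gt0.
pose x' := \sum_(i < N.+1) amplitude *: u i; pose y' := \sum_(i < N.+1) amplitude *: w i.
have nrm : amplitude ^+ 2 * N.+1%:R = radius ^+ 2.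
  by rewrite /amplitude expr_div_n sqr_sqrtr// divfK// pnatr_eq0.
have [nx ny] : dotp x' x' = radius ^+ 2 /\ dotp y' y' = radius ^+ 2.
  by have := chain_witness_norm amplitude ou ow; rewrite nrm.
have Xx : eball 0 radius x' by rewrite eball0E /= enorm_le// nx.
have Yy : eball 0 radius y' by rewrite eball0E /= enorm_le// ny.
have W := chain_witness g0 c0 ou ow ME (rsubmx z) zN.
have H : rate_constant * (L * D ^+ p.+1 / rate R p N) <=
    phi (row_mx (lsubmx z) y') - phi (row_mx x' (rsubmx z)).
  by apply: le_trans coefficient_ge _; exact: W.
have dphi t : differentiable phi t.
  by have [h _] := chain_smooth u w amplitude gapwidth coefficient N.+1 1; exact: h.
split; last first.
  apply: le_trans H _; apply: gap_ge => //; try exact: eball_compact.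
  by move=> t; exact: differentiable_continuous.
have [Xz Yz] := Zz.
apply: le_trans (tan_residual_ge D0 (dphi z) _ Xx Yy Xz Yz _).
- rewrite ler_pdivlMr//; apply: le_trans H; rewrite le_eqVlt exprSr.
  by apply/orP; left; apply/eqP; ring.
- exact: chain_convex_concave.
- apply: ball_prod_diam radiusE _ _ => //; first exact: ltW.
  by rewrite /prodset /= row_mxKl row_mxKr.
Qed.

End HardFunction.

(** Link k has to avoid k + 1 points and k earlier vectors in each factor, that is at most 2N + 1
    vectors, so dimension 2N + 2 suffices. *)
Lemma deterministic_bound (A : forall dom : domain R, policy p N dom) :
  exists dom : domain R,
     [/\ dimx dom = (2 * N + 2)%N /\ dimy dom = (2 * N + 2)%N,
         is_ball (setx dom),
         is_ball (sety dom),
         diam (setz dom) = D%:E &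
         exists phi : 'rV[R]_(dimx dom + dimy dom) -> R,
         [/\ smooth phi,
             convex_concave setT setT phi,
             lip_D p L setT phi,
             rate_constant * (L * D ^+ p / rate R p N)
               <= tan_residual (setx dom) (sety dom) phi
                    (result (A dom) phi) &
             rate_constant * (L * D ^+ p.+1 / rate R p N)
               <= gap (setx dom) (sety dom) phi (result (A dom) phi)]].
Proof.
pose d := (2 * N + 2)%N; pose dom := ball_domain d radius_ge0.
have isb : is_ball (setx dom) by exists 0, radius; split => //; exact: radius_gt0.
exists dom; split=> //.
  by apply: (diam_ball _ radius_ge0 (ltW D0) radiusE); rewrite /= /d addn2.
pose q u w t := point amplitude gapwidth coefficient (A dom) u w t.
pose Q k u w := forall t, (t <= k)%N ->
  dotp (u k) (lsubmx (q u w t)) = 0 /\ dotp (w k) (rsubmx (q u w t)) = 0.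
have [|k u w kN ou ow|u [w [ou ow HQ]]] := @greedy_frames R d Q N.+1.
- move=> k u w u' w' H HQ t tk.
  have [<- <-] := H k (leqnn k); rewrite /q -(@point_eq _ _ _ _ _ _ _ _ _ _ u w u' w').
    exact: HQ.
  by move=> i it; apply: H; rewrite (leq_trans (ltnW it)).
- have sz (f : nat -> 'rV[R]_d) v : (size ([seq f t | t <- iota 0 k.+1] ++
      [seq v i | i <- iota 0 k] : seq 'rV[R]_d) < d)%N.
    by rewrite size_cat !size_map !size_iota /d; lia.
  have [a a1 ax] := orthogonal_unit (sz (fun t => lsubmx (q u w t)) u).
  have [b b1 bx] := orthogonal_unit (sz (fun t => rsubmx (q u w t)) w).
  have mem (f v : nat -> 'rV[R]_d) i : (i < k)%N ->
      v i \in [seq f t | t <- iota 0 k.+1] ++ [seq v i | i <- iota 0 k].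
    by move=> ik; rewrite mem_cat orbC map_f// mem_iota.
  exists a, b; split.
  + by apply: orthonormal_upd => // i ik; apply: ax; exact: mem.
  + by apply: orthonormal_upd => // i ik; apply: bx; exact: mem.
  (* Replacing link k does not move the points t <= k, which were computed from links below t; the
     new vectors are orthogonal to the points actually visited. *)
  + move=> t tk; rewrite /q (@point_eq _ _ _ _ _ _ _ _ _ _ (upd u k a) (upd w k b) u w); last first.
      by move=> i it; rewrite !upd_lt// (leq_trans it).
    rewrite /upd eqxx; split; [apply: ax | apply: bx]; rewrite mem_cat;
      by apply/orP; left; apply/mapP; exists t => //; rewrite mem_iota.
- pose phi := chain u w amplitude gapwidth coefficient N.+1.
  have g0 := gapwidth_gt0; have g20 : 0 <= gapwidth / 2 by rewrite divr_ge0// ltW.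
  have res : result (A dom) phi = q u w N.
    apply: result_chain => // t i /andP[ti iN].
    by have [-> ->] := HQ i iN t ti; rewrite normr0.
  have [|h1 h2] := @hard_gap_residual d u w ou ow (q u w N) (point_feasible _ _ _ _ _ _ _).
    by have [-> _] := HQ N (ltnSn N) N (leqnn N); rewrite normr0.
  exists phi; split; rewrite ?res//.
  + exact: chain_smooth.
  + by apply: chain_convex_concave; exact: coefficient_ge0.
  + exact: hard_lip.
Qed.

End Instance.

(** * Hoeffding's inequality for random signs *)

Section Hoeffding.
Context {R : realType}.

(** For x^2 <= 1/2, e^y <= 1 / (1 - y) at y = x and y = -x sums to 2 / (1 - x^2), and (1 - x^2)(1 +
    2 x^2) >= 1. For larger x, already |x| <= 2 x^2. The weaker exponent 2 x^2 in place of x^2 / 2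
    only affects constants. *)
Lemma cosh_le (x : R) : expR x + expR (- x) <= 2 * expR (2 * x ^+ 2).
Proof.
have [x1|x1] := leP (x ^+ 2) 2^-1; last first.
  have x2 : `|x| <= 2 * x ^+ 2.
    rewrite -(real_normK (num_real x)) in x1 *.
    have := normr_ge0 x; move: (`|x|) x1 => y y1 y0; nra.
  have h (y : R) : y <= `|x| -> expR y <= expR (2 * x ^+ 2).
    by move=> yx; rewrite ler_expR (le_trans yx).
  by rewrite mulr_natl mulr2n lerD// h ?ler_norm// ler_normr lexx orbT.
have xx : 0 <= x ^+ 2 := sqr_ge0 x.
have [xl xu] : x < 1 /\ -1 < x by split; nra.
have h (y : R) : y < 1 -> expR y <= (1 - y)^-1.
  move=> y1; rewrite -[y in leLHS]opprK expRN lef_pV2 ?posrE ?expR_gt0 ?subr_gt0//.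
  exact: expR_ge1Dx.
have xl' : - x < 1 by lra.
have hx := h _ xl; have hx' := h _ xl'; rewrite opprK in hx'.
apply: (le_trans (lerD hx hx')).
have p1 : 0 < 1 - x by lra.
have p2 : 0 < 1 + x by lra.
have -> : (1 - x)^-1 + (1 + x)^-1 = 2 * (1 - x ^+ 2)^-1.
  field; rewrite !gt_eqF//; nra.
rewrite ler_wpM2l// -[leRHS]invrK lef_pV2 ?posrE ?invr_gt0 ?expR_gt0//; last by lra.
rewrite -[leLHS]mul1r ler_pdivrMr ?expR_gt0//.
have e0 := expR_ge1Dx (2 * x ^+ 2).
have : (1 - x ^+ 2) * (1 + 2 * x ^+ 2) <= (1 - x ^+ 2) * expR (2 * x ^+ 2).
  by rewrite ler_wpM2l//; lra.
move=> h1; apply: le_trans h1; nra.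
Qed.

Definition sgnb (b : bool) : R := (-1) ^+ b.

(** The uniform law is written as a sum over all sign vectors, with 2^m as total mass; this sum of
    products factors over the coordinates. *)
Lemma rademacher_mgf m (a : 'I_m -> R) :
  \sum_(e : {ffun 'I_m -> bool}) expR (\sum_j sgnb (e j) * a j) <=
  2 ^+ m * expR (2 * \sum_j a j ^+ 2).
Proof.
under eq_bigr do rewrite expR_sum.
rewrite -(bigA_distr_bigA (fun j b => expR (sgnb b * a j))).
have -> : 2 ^+ m = \prod_(j < m) 2 :> R by rewrite prodr_const card_ord.
rewrite mulr_sumr expR_sum -big_split/=.
apply: ler_prod => j _; apply/andP; split.
  by apply: sumr_ge0 => b _; exact: expR_ge0.
rewrite big_bool /= /sgnb expr1 expr0 mulN1r mul1r addrC; exact: cosh_le.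
Qed.

Lemma rademacher_tail m (a : 'I_m -> R) (A t : R) : 0 < A -> 0 <= t ->
  \sum_j a j ^+ 2 <= A ->
  \sum_(e : {ffun 'I_m -> bool}) (t < `|\sum_j sgnb (e j) * a j|)%R%:R <=
  2 ^+ m * (2 * expR (- (t ^+ 2 / (8 * A)))).
Proof.
(* Chernoff parameter: it minimises 2 A l^2 - l t, with minimum -t^2 / (8 A). *)
move=> A0 t0 aA; pose l := t / (4 * A).
have l0 : 0 <= l by rewrite divr_ge0// mulr_ge0// ltW.
have one (b : 'I_m -> R) : \sum_j b j ^+ 2 <= A ->
    \sum_(e : {ffun 'I_m -> bool}) expR (l * \sum_j sgnb (e j) * b j - l * t) <=
    2 ^+ m * expR (- (t ^+ 2 / (8 * A))).
  move=> bA; under eq_bigr do rewrite expRD.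
  rewrite -mulr_suml.
  have h := @rademacher_mgf m (fun j => l * b j).
  have -> : \sum_(e : {ffun 'I_m -> bool}) expR (l * \sum_j sgnb (e j) * b j) =
      \sum_(e : {ffun 'I_m -> bool}) expR (\sum_j sgnb (e j) * (l * b j)).
    by apply: eq_bigr => e _; rewrite mulr_sumr; congr expR; apply: eq_bigr => j _; rewrite mulrCA.
  apply: le_trans (ler_wpM2r (expR_ge0 _) h) _.
  rewrite -mulrA -expRD ler_wpM2l ?exprn_ge0// ler_expR.
  under eq_bigr do rewrite exprMn.
  rewrite -mulr_sumr.
  have h1 : l ^+ 2 * \sum_j b j ^+ 2 <= l ^+ 2 * A by rewrite ler_wpM2l// sqr_ge0.
  have -> : - (t ^+ 2 / (8 * A)) = 2 * (l ^+ 2 * A) - l * t.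
    by rewrite /l; field; rewrite gt_eqF.
  by lra.
rewrite [leRHS]mulrCA [leRHS]mulr_natl [leRHS]mulr2n.
have aA' : \sum_j (- a j) ^+ 2 <= A by under eq_bigr do rewrite sqrrN.
apply: le_trans _ (lerD (one _ aA) (one _ aA')); rewrite -big_split/=.
apply: ler_sum => e _; set S := \sum_j sgnb (e j) * a j.
have -> : \sum_j sgnb (e j) * - a j = - S.
  by rewrite -sumrN; apply: eq_bigr => j _; rewrite mulrN.
have [tS|_] := ltP t `|S|; last by rewrite addr_ge0// expR_ge0.
have le1 (x : R) : 0 <= x -> 1 <= expR x by move=> x0; rewrite -[leLHS]expR0 ler_expR.
rewrite lter_normr in tS; case/orP: tS => tS.
  by apply: ler_wpDr; [exact: expR_ge0 | apply: le1; rewrite -mulrBr mulr_ge0// subr_ge0 ltW].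
by apply: ler_wpDl; [exact: expR_ge0 | apply: le1; rewrite -mulrBr mulr_ge0// subr_ge0 ltW].
Qed.

End Hoeffding.

(** * Measurability of the run *)

Section CoordinateMeasurability.
Context {R : realType} d (Om : measurableType d) {n : nat}.
Implicit Types (q : Om -> 'rV[R]_n).

Definition coord_measurable q :=
  forall i, measurable_fun [set: Om] (fun w => q w 0 i : measurableTypeR R).

Lemma measurable_box q (c : 'rV[R]_n) (e : R) : coord_measurable q ->
  measurable [set w | forall i, q w 0 i \in `]c 0 i - e, c 0 i + e[].
Proof.
move=> mq; rewrite (_ : [set _ | _] = \bigcap_(i in [set: 'I_n])
    [set w | q w 0 i \in `]c 0 i - e, c 0 i + e[]); last first.
  by apply/seteqP; split=> w h i; [move=> _; exact: h | exact: (h i I)].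
apply: fin_bigcap_measurable => // i _.
rewrite -[X in measurable X]setTI.
exact: (mq i measurableT _ (measurable_itv _)).
Qed.

(** An open set is the countable union of the rational boxes it contains; [unpickle] enumerates
    centres and widths. *)
Lemma measurable_open q (U : set 'rV[R]_n) : coord_measurable q -> open U ->
  measurable [set w | U (q w)].
Proof.
move=> mq oU.
pose box (c : 'rV[rat]_n * nat) : set 'rV[R]_n := [set z | forall i,
   z 0 i \in `]ratr (c.1 0 i) - c.2.+1%:R^-1, ratr (c.1 0 i) + c.2.+1%:R^-1[].
pose B k : set 'rV[R]_n := if unpickle k is Some c then
  (if `[< box c `<=` U >] then box c else set0) else set0.
have UE : U = \bigcup_k B k.
  apply/seteqP; split=> [z Uz|z [k _]]; last first.
    rewrite /B; case: (unpickle k) => // c; case: asboolP => // h; exact: h.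
  have := open_nbhs_nbhs (conj oU Uz); rewrite -nbhs_ballE => -[e /= e0 eU].
  have [k ke] : exists k, k.+1%:R^-1 <= e / 2 :> R.
    have e20 : 0 < e / 2 by rewrite divr_gt0.
    have [k hk] := ltr_add_invr (e20); exists k; rewrite add0r in hk; exact: ltW.
  have dk : 0 < k.+1%:R^-1 :> R by rewrite invr_gt0 ltr0n.
  have /choice[c cP] : forall i : 'I_n, exists q0 : rat,
      z 0 i - k.+1%:R^-1 < ratr q0 < z 0 i + k.+1%:R^-1.
    move=> i; have [|q0 hq] := @rat_in_itvoo R (z 0 i - k.+1%:R^-1) (z 0 i + k.+1%:R^-1).
      by rewrite ltrD2l -subr_gt0 opprK addr_gt0.
    by exists q0; rewrite in_itv /= in hq.
  pose cc : 'rV[rat]_n * nat := (\row_i c i, k).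
  exists (pickle cc) => //; rewrite /B pickleK asboolT.
    move=> i; rewrite /cc /= mxE in_itv /=.
    by have /andP[h1 h2] := cP i; rewrite ltrBlDr h2 -ltrBlDr.
  move=> y yb; apply: eU; split=> // i j; rewrite (ord1 i) /ball/= ltr_norml.
  have := yb j; rewrite /cc /= mxE in_itv /= => /andP[h3 h4].
  have /andP[h1 h2] := cP j; move: h1 h2 h3 h4 ke.
  by move: (k.+1%:R^-1) (ratr _) => a b *; apply/andP; split; lra.
rewrite UE (_ : [set _ | _] = \bigcup_k [set w | B k (q w)]); last by [].
apply: bigcupT_measurable => k; rewrite /B; case: (unpickle k) => [c|]; last first.
  by rewrite (_ : [set _ | _] = set0).
case: asboolP => _; last by rewrite (_ : [set _ | _] = set0).
have -> : [set w | box c (q w)] = [set w | forall i, q w 0 i \in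
   `](map_mx ratr c.1 : 'rV[R]_n) 0 i - c.2.+1%:R^-1,
     (map_mx ratr c.1 : 'rV[R]_n) 0 i + c.2.+1%:R^-1[].
  by apply/seteqP; split=> w h i; have := h i; rewrite mxE.
exact: measurable_box.
Qed.

Lemma measurable_closed q (C : set 'rV[R]_n) : coord_measurable q -> closed C ->
  measurable [set w | C (q w)].
Proof.
move=> mq cC; rewrite (_ : [set _ | _] = ~` [set w | (~` C) (q w)]).
  by apply: measurableC; apply: measurable_open => //; exact: closed_openC.
by apply/seteqP; split=> w /= h; [move=> /(_ h) | exact: contrapT].
Qed.

Lemma measurable_continuous q (f : 'rV[R]_n -> R) : coord_measurable q -> continuous f ->
  measurable_fun [set: Om] (fun w => f (q w) : measurableTypeR R).
Proof.
move=> mq cf; apply: (measurability _ (measurable_realfun.RGenOInfty.measurableE R)) => //.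
move=> _ [_ [x ->] <-]; rewrite setTI.
rewrite (_ : _ @^-1` _ = [set w | (f @^-1` [set y | x < y]) (q w)]); last first.
  by apply/seteqP; split=> w; rewrite /= in_itv/= andbT.
apply: measurable_open => //; apply: open_comp; last exact: open_gt.
by move=> z _; exact: cf.
Qed.

End CoordinateMeasurability.

Section RandomRun.
Context {R : realType} d (Om : measurableType d) (p N : nat) (dom : domain R).
Let n := (dimx dom + dimy dom)%N.
Variables (A : Om -> policy p N dom) (phi : 'rV[R]_n -> R).
Hypothesis mA : measurable_policy A.
Hypothesis cphi : forall vs, continuous (Dform phi vs).

Definition run_step w (h : history p n) : history p n :=
  if stop (A w) h then h else rcons h (query (A w) h, jet p phi (query (A w) h)).

Lemma transcriptE w t : transcript (A w) phi t = iter t (run_step w) [::].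
Proof. by elim: t => //= t <-. Qed.

(** The run with stopping ignored. Its history after k steps has length exactly k and so fits
    [history_code], on which measurability of a policy is stated length by length. *)
Fixpoint unstopped w k : history p n :=
  if k is k'.+1 then let h := unstopped w k' in
    rcons h (query (A w) h, jet p phi (query (A w) h)) else [::].

Let pt w k := query (A w) (unstopped w k).

Let code k w : history_code p n k := [tuple
  ([tuple (pt w i) 0 j | j < n],
   [tuple jet p phi (pt w i) (enum_val a) | a < #|jet_index n p|]) | i < k].

Lemma decode_code k w : decode (code k w) = unstopped w k.
Proof.
have -> : unstopped w k = [seq (pt w i, jet p phi (pt w i)) | i <- iota 0 k].
  elim: k => [//|k IH]; rewrite -addn1 iotaD map_cat -IH /= add0n addn1 /=.
  by rewrite cats1.
rewrite /decode /code /= -val_enum_ord -!map_comp.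
apply: eq_map => i /=; congr (_, _).
  by apply/rowP => j; rewrite mxE tnth_mktuple.
by apply/ffunP => a; rewrite [LHS]ffunE tnth_mktuple enum_rankK.
Qed.

Lemma measurable_jet q (a : jet_index n p) : coord_measurable q ->
  measurable_fun [set: Om] (fun w => jet p phi (q w) a : measurableTypeR R).
Proof.
move=> mq; have := measurable_continuous mq (@cphi [seq delta_mx 0 i : 'rV[R]_n | i <- tagged a]).
by congr (measurable_fun _ _); apply/funext => w; rewrite [RHS]ffunE.
Qed.

Let measurable_code_lt k : (forall i, (i < k)%N -> coord_measurable (pt^~ i)) ->
  measurable_fun [set: Om] (code k).
Proof.
move=> H; apply/measurable_fun_tnthP => i.
rewrite (_ : _ \o _ = fun w => ([tuple (pt w i) 0 j | j < n],
   [tuple jet p phi (pt w i) (enum_val a) | a < #|jet_index n p|])); last first.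
  by apply/funext => w /=; rewrite tnth_mktuple.
apply: measurable_fun_pair; apply/measurable_fun_tnthP => j.
  rewrite (_ : _ \o _ = fun w => (pt w i) 0 j); first exact: H.
  by apply/funext => w /=; rewrite tnth_mktuple.
rewrite (_ : _ \o _ = fun w => jet p phi (pt w i) (enum_val j)).
  exact: measurable_jet (H _ _).
by apply/funext => w /=; rewrite tnth_mktuple.
Qed.

Let measurable_pt k : coord_measurable (pt^~ k).
Proof.
elim/ltn_ind: k => k IH i.
rewrite (_ : (fun w => _) = (fun wh => query (A wh.1) (decode wh.2) 0 i)
    \o (fun w => (w, code k w))); last first.
  by apply/funext => w /=; rewrite decode_code.
have [_ mq _] := mA k.
apply: measurableT_comp; first exact: mq.
by apply: measurable_fun_pair; [exact: measurable_id | exact: measurable_code_lt].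
Qed.

Let measurable_code k : measurable_fun [set: Om] (code k).
Proof. by apply: measurable_code_lt => i _; exact: measurable_pt. Qed.

(** Generalised to runs that start from an unstopped prefix: such a run either stops at once,
    leaving that prefix, or continues from the prefix one step longer. *)
Lemma measurable_transcript (F : policy p N dom -> history p n -> 'rV[R]_n) t :
  (forall k i, measurable_fun [set: Om * history_code p n k]
     (fun wh => F (A wh.1) (decode wh.2) 0 i : measurableTypeR R)) ->
  coord_measurable (fun w => F (A w) (transcript (A w) phi t)).
Proof.
move=> mF i.
suff H k : measurable_fun [set: Om] (fun w =>
    F (A w) (iter t (run_step w) (unstopped w k)) 0 i : measurableTypeR R).
  by under eq_fun do rewrite transcriptE; exact: (H 0%N).
have mFk k' : measurable_fun [set: Om] (fun w =>
    F (A w) (unstopped w k') 0 i : measurableTypeR R).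
  rewrite (_ : (fun w => _) = (fun wh => F (A wh.1) (decode wh.2) 0 i)
    \o (fun w => (w, code k' w))); last first.
    by apply/funext => w /=; rewrite decode_code.
  apply: measurableT_comp; first exact: mF.
  by apply: measurable_fun_pair; [exact: measurable_id | exact: measurable_code].
elim: t k => [|t IH] k; first exact: mFk.
rewrite (_ : (fun w => _) = fun w => if stop (A w) (unstopped w k)
    then F (A w) (unstopped w k) 0 i
    else F (A w) (iter t (run_step w) (unstopped w k.+1)) 0 i); last first.
  apply/funext => w; rewrite iterSr {2}/run_step; case: ifPn => // st.
  by rewrite iter_fix// /run_step st.
apply: measurable_fun_ifT => //.
rewrite (_ : (fun w => _) = (fun wh => stop (A wh.1) (decode wh.2))
    \o (fun w => (w, code k w))); last first.
  by apply/funext => w /=; rewrite decode_code.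
have [ms _ _] := mA k.
apply: measurableT_comp; first exact: ms.
by apply: measurable_fun_pair; [exact: measurable_id | exact: measurable_code].
Qed.

Lemma measurable_query_point t :
  coord_measurable (fun w => query (A w) (transcript (A w) phi t)).
Proof. by apply: (measurable_transcript (F := @query _ _ _ _)) => k; have [] := mA k. Qed.

Lemma measurable_output_point t :
  coord_measurable (fun w => output (A w) (transcript (A w) phi t)).
Proof. by apply: (measurable_transcript (F := @output _ _ _ _)) => k; have [] := mA k. Qed.

End RandomRun.

(** * Measurability of the gap and residual events *)

Section Events.
Context {R : realType} d (Om : measurableType d) (dx dy : nat).
Variables (X : set 'rV[R]_dx) (Y : set 'rV[R]_dy) (phi : 'rV[R]_(dx + dy) -> R).
Variable (q : Om -> 'rV[R]_(dx + dy)).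
Hypotheses (cX : compact X) (cY : compact Y).
Hypotheses (mq : coord_measurable q) (qZ : forall w, prodset X Y (q w)).

Lemma prodset_compact : compact (prodset X Y).
Proof.
have -> : prodset X Y = (fun z : 'rV[R]_dx * 'rV[R]_dy => row_mx z.1 z.2) @` (X `*` Y).
  apply/seteqP; split=> [z [Xz Yz]|_ [[x y] [Xx Yy] <-]]; last first.
    by rewrite /prodset /= row_mxKl row_mxKr.
  by exists (lsubmx z, rsubmx z) => //=; rewrite hsubmxK.
apply: continuous_compact; last exact: compact_setX.
apply: continuous_subspaceT; apply: continuous_row_mx => i z.
  by apply: (@continuous_comp _ _ _ fst (fun x : 'rV[R]_dx => x 0 i)); [exact: cvg_fst | exact: coord_continuous].
by apply: (@continuous_comp _ _ _ snd (fun x : 'rV[R]_dy => x 0 i)); [exact: cvg_snd | exact: coord_continuous].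
Qed.

Let V : topologicalType := ('rV[R]_(dx + dy) * 'rV[R]_(dx + dy))%type.

Let coord1 i : continuous (fun z : V => z.1 0 i : R).
Proof.
move=> z; apply: (@continuous_comp _ _ _ fst (fun x : 'rV[R]_(dx + dy) => x 0 i)).
  exact: cvg_fst.
exact: coord_continuous.
Qed.

Let coord2 i : continuous (fun z : V => z.2 0 i : R).
Proof.
move=> z; apply: (@continuous_comp _ _ _ snd (fun x : 'rV[R]_(dx + dy) => x 0 i)).
  exact: cvg_snd.
exact: coord_continuous.
Qed.

(** The projection of a compact set is compact, hence closed, so an existential over a compact set
    stays measurable. *)
Let measurable_proj (K : set V) : compact K -> measurable [set w | (fst @` K) (q w)].
Proof.
move=> cK; apply: measurable_closed => //; apply: compact_closed; first exact: norm_hausdorff.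
apply: continuous_compact => //; apply: continuous_subspaceT => z; exact: cvg_fst.
Qed.

(** Since the maximum and the minimum are attained, the gap at z is at least b exactly when some z'
    in the compact product satisfies G(z, z') <= -b. *)
Lemma measurable_gap_event b : continuous phi ->
  measurable [set w | b <= gap X Y phi (q w)].
Proof.
move=> cphi.
pose G (z : V) := phi (row_mx (lsubmx z.2) (rsubmx z.1)) - phi (row_mx (lsubmx z.1) (rsubmx z.2)).
have cG : continuous G.
  move=> z; apply: continuousB; (apply: continuous_comp; last exact: cphi);
    apply: continuous_row_mx => i; under eq_fun do rewrite mxE; by [exact: coord1 | exact: coord2].
pose K : set V := (prodset X Y `*` prodset X Y) `&` [set z | G z <= - b].
rewrite (_ : [set _ | _] = [set w | (fst @` K) (q w)]).
  apply: measurable_proj; apply: (subclosed_compact _ (compact_setX prodset_compact prodset_compact)).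
    apply: closedI; last exact: closed_le_fun.
    apply: compact_closed; first exact: norm_hausdorff.
    exact: (compact_setX prodset_compact prodset_compact).
  by move=> z [].
apply/seteqP; split=> w /=; last first.
  move=> [[z z'] [[/= Zz [Xz' Yz']] GK] /= <-].
  apply: le_trans (gap_ge _ cX cY cphi Xz' Yz').
  by move: GK; rewrite /G /=; lra.
have [Xq Yq] := qZ w; move=> bg.
have cfy : continuous (fun y => phi (row_mx (lsubmx (q w)) y)).
  move=> y; apply: continuous_comp; last exact: cphi.
  by apply: continuous_row_mx => i t; [exact: cst_continuous | exact: coord_continuous].
have cfx : continuous (fun x => phi (row_mx x (rsubmx (q w)))).
  move=> x; apply: continuous_comp; last exact: cphi.
  by apply: continuous_row_mx => i t; [exact: coord_continuous | exact: cst_continuous].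
have [|y + Hy] := @compact_EVT_max _ _ _ Y _ cY (continuous_subspaceT cfy).
  by exists (rsubmx (q w)).
have [|x + Hx] := @compact_EVT_min _ _ _ X _ cX (continuous_subspaceT cfx).
  by exists (lsubmx (q w)).
rewrite !inE => Xx Yy.
exists (q w, row_mx x y) => //; split.
  by split=> //; rewrite /prodset /= row_mxKl row_mxKr.
rewrite /G /= row_mxKl row_mxKr.
have h1 : sup [set phi (row_mx (lsubmx (q w)) y0) | y0 in Y] <= phi (row_mx (lsubmx (q w)) y).
  apply: ge_sup; first by exists (phi (row_mx (lsubmx (q w)) y)), y.
  by move=> _ [y0 Y0 <-]; apply: Hy; rewrite inE.
have h2 : phi (row_mx x (rsubmx (q w))) <= inf [set phi (row_mx x0 (rsubmx (q w))) | x0 in X].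
  apply: lb_le_inf; first by exists (phi (row_mx x (rsubmx (q w)))), x.
  by move=> _ [x0 X0 <-]; apply: Hx; rewrite inE.
by move: bg; rewrite /gap; lra.
Qed.

(** The complement is a countable union of projections of compact sets: the residual at z is below a
    exactly when, for some k, an element m of F(z) + N_Z(z) has norm at most a - 1/(k+1). The normal
    cone condition is an intersection of closed conditions in (z, m). *)
Lemma measurable_residual_event a :
  (forall i, continuous ('D_(delta_mx 0 i) phi)) ->
  measurable [set w | a <= tan_residual X Y phi (q w)].
Proof.
move=> cD.
have cF i : continuous (fun z => saddle_op phi z 0 i).
  case: (split_ordP i) => j ->.
    rewrite (_ : (fun z => _) = 'D_(delta_mx 0 (lshift dy j)) phi); first exact: cD.
    by apply/funext => z; rewrite /saddle_op row_mxEl !mxE.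
  rewrite (_ : (fun z => _) = (fun z => - 'D_(delta_mx 0 (rshift dx j)) phi z)).
    by move=> z; have h := @cD (rshift dx j) z; exact: (cvgN h).
  by apply/funext => z; rewrite /saddle_op row_mxEr !mxE.
have cF1 i : continuous (fun z : V => saddle_op phi z.1 0 i).
  move=> z; apply: (@continuous_comp _ _ _ fst (fun x => saddle_op phi x 0 i)).
    exact: cvg_fst.
  exact: cF.
pose B (k : nat) : set 'rV[R]_(dx + dy) := eball 0 (a - k.+1%:R^-1).
pose K k : set V := (prodset X Y `*` B k) `&`
  \bigcap_(z' in prodset X Y) [set z | dotp (z.2 - saddle_op phi z.1) (z' - z.1) <= 0].
have cK k : compact (K k).
  have cZB : compact (prodset X Y `*` B k).
    by apply: compact_setX; [exact: prodset_compact | exact: eball_compact].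
  apply: (subclosed_compact _ cZB); last by move=> z [].
  apply: closedI; first by apply: compact_closed cZB; exact: norm_hausdorff.
  apply: closed_bigI => z' _; apply: closed_le_fun; apply: continuous_dotp => i.
    rewrite (_ : (fun t => _) = (fun z : V => z.2 0 i - saddle_op phi z.1 0 i)).
      by move=> z; apply: continuousB; [exact: coord2 | exact: cF1].
    by apply/funext => z; rewrite !mxE.
  rewrite (_ : (fun t => _) = (fun z : V => z' 0 i - z.1 0 i)).
    by move=> z; apply: continuousB; [exact: cst_continuous | exact: coord1].
  by apply/funext => z; rewrite !mxE.
rewrite (_ : [set _ | _] = ~` \bigcup_k [set w | (fst @` K k) (q w)]).
  by apply: measurableC; apply: bigcupT_measurable => k; apply: measurable_proj; exact: cK.
have S0 z : [set enorm (saddle_op phi z + v) | v in normal_cone (prodset X Y) z] !=set0.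
  by exists (enorm (saddle_op phi z + 0)), 0 => // z' _; rewrite dotp0l.
apply/seteqP; split=> w /=.
  move=> ar [k _ [[z m] [[/= Zz mB] /= H] zq]]; rewrite /= in zq; rewrite -zq in ar.
  move: mB; rewrite /B eball0E /= => mB.
  suff : tan_residual X Y phi z <= enorm m.
    move=> h; have := le_trans ar (le_trans h mB).
    by rewrite lerDl oppr_ge0 leNgt invr_gt0 ltr0n.
  apply: ge_inf; first by exists 0 => _ [v _ <-]; exact: enorm_ge0.
  by exists (m - saddle_op phi z); [move=> z' Zz'; exact: H | rewrite addrC subrK].
move=> H; rewrite leNgt; apply/negP => ra; apply: H.
have [_ [v vN <-] va] := inf_lt (S0 (q w)) ra.
have [k hk] := ltr_add_invr va.
exists k => //; exists (q w, saddle_op phi (q w) + v) => //; split.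
  by split=> //=; rewrite /B eball0E /= lerBrDr ltW.
by move=> z' Zz' /=; rewrite addrC addKr; exact: vN.
Qed.

End Events.

(** * Resisting randomized algorithms *)

Section Averaging.
Context {R : realType} d (Om : measurableType d) (P : probability Om R).

Lemma integral_sum_events (E : finType) (B : E -> set Om) :
  (forall e, measurable (B e)) ->
  (\sum_e P (B e) = \int[P]_w (\sum_e (\1_(B e) w)%:E))%E.
Proof.
move=> mB; rewrite ge0_integral_sum//.
- by apply: eq_bigr => e _; rewrite integral_indic// setIT.
- by move=> e; apply/measurable_EFinP; exact: measurable_indic.
Qed.

Lemma sum_events_le (E : finType) (B : E -> set Om) (c : R) :
  (forall e, measurable (B e)) -> (forall w, \sum_e \1_(B e) w <= c) ->
  (\sum_e P (B e) <= c%:E)%E.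
Proof.
move=> mB Bc; rewrite integral_sum_events//.
apply: (@le_trans _ _ (\int[P]_w (cst c%:E w))%E).
  apply: ge0_le_integral => //.
  - by move=> w _; apply: sume_ge0 => e _; rewrite lee_fin.
  - by apply: emeasurable_sum => e; apply/measurable_EFinP; exact: measurable_indic.
  - by move=> w _ /=; rewrite sumEFin lee_fin.
rewrite integral_cst// [X in (_ * X)%E](_ : _ = 1%E) ?mule1//.
exact: probability_setT.
Qed.

(** If for every seed the fraction of bad e is at most c, then integrating over the seed bounds the
    average of [P (B e)] by c, so some e does no worse. *)
Lemma exists_event_le (E : finType) (B : E -> set Om) (c : R) : (0 < #|E|)%N ->
  (forall e, measurable (B e)) -> (forall w, \sum_e \1_(B e) w <= #|E|%:R * c) ->
  exists e, (P (B e) <= c%:E)%E.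
Proof.
move=> E0 mB Bc; apply: contrapT => /forallNP H.
have := sum_events_le mB Bc; apply/negP; rewrite -ltNge.
have -> : (#|E|%:R * c)%:E = (\sum_(e : E) c%:E)%E.
  by rewrite sumEFin sumr_const -(mulr_natl c).
have fP e : P (B e) = (fine (P (B e)))%:E by rewrite fineK// fin_num_measure.
under [X in (_ < X)%E]eq_bigr do rewrite fP.
rewrite !sumEFin lte_fin; have [e0 _] : exists e0 : E, e0 \in E by apply/card_gt0P.
apply: ltr_sum; first by apply/hasP; exists e0 => //; rewrite mem_index_enum.
by move=> e _; rewrite -lte_fin -fP ltNge; apply/negP; exact: H.
Qed.

Lemma union_event_le (k : nat) (B : 'I_k -> set Om) (U : set Om) (c : R) :
  (forall i, measurable (B i)) -> measurable U ->
  (forall w, U w -> exists i, B i w) -> (forall i, (P (B i) <= c%:E)%E) ->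
  (P U <= (k%:R * c)%:E)%E.
Proof.
move=> mB mU UB Bc; apply: (@le_trans _ _ (\sum_i P (B i))%E); last first.
  apply: (@le_trans _ _ (\sum_(i < k) c%:E)%E); first exact: lee_sum.
  by rewrite sumEFin sumr_const card_ord mulr_natl.
rewrite integral_sum_events// [leLHS](_ : _ = \int[P]_w (\1_U w)%:E)%E; last first.
  by rewrite integral_indic// setIT.
apply: ge0_le_integral => //.
- by apply/measurable_EFinP; exact: measurable_indic.
- by apply: emeasurable_sum => e; apply/measurable_EFinP; exact: measurable_indic.
move=> w _; rewrite sumEFin lee_fin.
have S0 : 0 <= \sum_i \1_(B i) w :> R by apply: sumr_ge0.
rewrite [leLHS]indicE; case: (boolP (w \in U)) => //; rewrite inE => /UB[i Bi].
rewrite (bigD1 i)//= indicE mem_set// lerDl; exact: sumr_ge0.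
Qed.

End Averaging.

Section Randomized.
Context {R : realType}.
Variables (p N : nat) (L D K : R).
Hypotheses (p2 : (2 <= p)%N) (L0 : 0 < L) (D0 : 0 < D) (K0 : 0 <= K).
Hypothesis HK : forall i j (s t s' t' : R), (i + j = p)%N ->
  `|coupling i j s t - coupling i j s' t'| <= K * (`|s - s'| + `|t - t'|).

Let r : R := radius D.
Let gw : R := gapwidth N D.

Section FixedDimension.
Variables (m : nat).
Hypothesis m0 : (0 < m)%N.
(** Union bound for one link: at most N + 1 points, two factors and two tails each give 4 (N + 1)
    exp(...), which must not exceed the share 1 / (4 (N + 1)) of the failure probability. *)
Hypothesis tail : 16 * N.+1%:R ^+ 2 * expR (- ((gw / 2) ^+ 2 / (8 * (r ^+ 2 / m%:R)))) <= 1.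

Let dim := (m + N)%N.
Let dom := ball_domain dim (radius_ge0 D0).
Let M := amplitude N D.
Let c := coefficient p N L D K.

Variables (dsp : measure_display) (Om : measurableType dsp) (P : probability Om R).
Variable (A : Om -> policy p N dom).
Hypothesis mA : measurable_policy A.
Implicit Types (u w : nat -> 'rV[R]_dim).

Let q u w t om : 'rV[R]_(dim + dim) := point M gw c (A om) u w t.

Let cchain u w t vs : continuous (Dform (chain u w M gw c t) vs).
Proof.
by move=> z; apply: differentiable_continuous; case: (chain_hasD u w M gw c t vs z).
Qed.

Let measurable_q u w t : coord_measurable (q u w t).
Proof.
rewrite /q /point; case: (t < N)%N.
  exact: (measurable_query_point mA (@cchain u w t)).
exact: (measurable_output_point mA (@cchain u w t)).
Qed.

Let off (a b : 'rV[R]_dim) (z : 'rV[R]_(dim + dim)) : bool :=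
  (gw / 2 < `|dotp a (lsubmx z)|) || (gw / 2 < `|dotp b (rsubmx z)|).

Let bad u w k : set Om :=
  [set om | exists t : 'I_k.+1, off (u k) (w k) (q u w t om)].

Let measurable_off a b u w t : measurable [set om | off a b (q u w t om)].
Proof.
have meas (f : 'rV[R]_(dim + dim) -> R) : continuous f ->
    measurable [set om | gw / 2 < `|f (q u w t om)|].
  move=> cf; apply: (measurable_open (U := [set z | gw / 2 < `|f z|])) => //.
  apply: (@open_comp _ _ (fun z => `|f z|) [set s | gw / 2 < s]); last exact: open_gt.
  by move=> z _; apply: continuous_comp; [exact: cf | exact: norm_continuous].
rewrite (_ : [set _ | _] = [set om | gw / 2 < `|dotp (row_mx a 0) (q u w t om)|] `|`
    [set om | gw / 2 < `|dotp (row_mx 0 b) (q u w t om)|]).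
  by apply: measurableU; apply: meas; apply: continuous_dotp => i z;
     [exact: cst_continuous | exact: coord_continuous |
      exact: cst_continuous | exact: coord_continuous].
apply/funext => om; apply/propext; rewrite /off /=.
rewrite -[in dotp (row_mx a 0) _](hsubmxK (q u w t om)) -[in dotp (row_mx 0 b) _](hsubmxK (q u w t om)).
rewrite !dotp_row_mx !dotp0l addr0 add0r.
by split=> /orP.
Qed.

Let measurable_bad u w k : measurable (bad u w k).
Proof.
rewrite (_ : bad u w k = \bigcup_(t in [set: 'I_k.+1])
  [set om | off (u k) (w k) (q u w t om)]).
  by apply: fin_bigcup_measurable => // t _.
by apply/seteqP; split=> om [t]; exists t.
Qed.

(** Normalised by sqrt m, so it is a unit vector for every choice of signs and the frame is exactly
    orthonormal; only its correlation with the points is random. *)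
Let signed (e : {ffun 'I_m -> bool}) (b : nat -> 'rV[R]_dim) : 'rV[R]_dim :=
  \sum_(j < m) ((Num.sqrt m%:R)^-1 * sgnb (e j)) *: b j.

Let signed_norm e b : orthonormal m b -> dotp (signed e b) (signed e b) = 1.
Proof.
move=> ob; rewrite sqr_orthonormal_sum//.
have h j : ((Num.sqrt m%:R)^-1 * sgnb (e j)) ^+ 2 = (m%:R)^-1 :> R.
  by rewrite exprMn exprVn sqr_sqrtr// /sgnb -exprM mulnC exprM sqrrN expr1n expr1n mulr1.
by under eq_bigr do rewrite h; rewrite sumr_const card_ord -(mulr_natl m%:R^-1) divff// pnatr_eq0 -lt0n.
Qed.

(** By Bessel the coefficients of the sign sum have squares adding up to at most r^2 / m. *)
Let signed_tail b x : orthonormal m b -> dotp x x <= r ^+ 2 ->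
  \sum_(e : {ffun 'I_m -> bool}) (gw / 2 < `|dotp (signed e b) x|)%R%:R <=
  2 ^+ m * (2 * expR (- ((gw / 2) ^+ 2 / (8 * (r ^+ 2 / m%:R))))).
Proof.
move=> ob xr; have mp : 0 < m%:R :> R by rewrite ltr0n.
have r0 : 0 < r := radius_gt0 D0.
have -> : \sum_(e : {ffun 'I_m -> bool}) (gw / 2 < `|dotp (signed e b) x|)%R%:R =
  \sum_(e : {ffun 'I_m -> bool})
    (gw / 2 < `|\sum_j sgnb (e j) * ((Num.sqrt m%:R)^-1 * dotp (b j) x)|)%R%:R :> R.
  apply: eq_bigr => e _; rewrite /signed dotp_suml.
  by under eq_bigr do rewrite dotpZl mulrAC mulrC.
apply: rademacher_tail.
- by rewrite divr_gt0// exprn_gt0.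
- by rewrite divr_ge0// ltW// gapwidth_gt0.
under eq_bigr do rewrite exprMn exprVn sqr_sqrtr ?ler0n//.
rewrite -mulr_sumr mulrC ler_pM2r ?invr_gt0//.
exact: le_trans (bessel x ob) xr.
Qed.

(** The points t <= k do not depend on link k, so for each fixed seed Hoeffding bounds the fraction
    of bad signs; averaging then fixes signs that serve most seeds. At most N earlier links have to
    be avoided, which leaves m directions in dimension m + N. *)
Lemma random_frames : exists u w, [/\ orthonormal N.+1 u, orthonormal N.+1 w &
  forall k, (k < N.+1)%N -> (P (bad u w k) <= (1 / (4 * N.+1%:R))%:E)%E].
Proof.
apply: (@greedy_frames R dim (fun k u w => (P (bad u w k) <= (1 / (4 * N.+1%:R))%:E)%E)).
  move=> k u w u' w' H; suff -> : bad u w k = bad u' w' k by [].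
  apply/funext => om; apply/propext; rewrite /bad /=; have [-> ->] := H k (leqnn k).
  have e (t : 'I_k.+1) : q u w t om = q u' w' t om.
    by apply: point_eq => i it; apply: H; rewrite (leq_trans (ltnW it))// -ltnS.
  by split=> -[t h]; exists t; [rewrite -e | rewrite e].
move=> k u w kN ou ow.
have sz (v : nat -> 'rV[R]_dim) : (size [seq v i | i <- iota 0 k] + m <= dim)%N.
  by rewrite size_map size_iota /dim addnC leq_add2l -ltnS.
have [b ob bu] := orthogonal_frame (sz u).
have [b' ob' bw] := orthogonal_frame (sz w).
have sig v f e i : (forall j x, (j < m)%N -> x \in [seq v i | i <- iota 0 k] -> dotp (f j) x = 0) ->
    (i < k)%N -> dotp (signed e f) (v i) = 0.
  move=> fv ik; rewrite dotp_suml big1// => j _; rewrite dotpZl fv ?mulr0//.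
  by apply: map_f; rewrite mem_iota.
pose ue e := upd u k (signed e b); pose we e := upd w k (signed e b').
have [||om|e He] := @exists_event_le R _ Om P {ffun 'I_m -> bool}
    (fun e => bad (ue e) (we e) k) (1 / (4 * N.+1%:R)).
- by rewrite card_ffun card_bool expn_gt0.
- by move=> e; exact: measurable_bad.
- rewrite card_ffun card_bool card_ord natrX.
  have qe e (t : 'I_k.+1) : q (ue e) (we e) t om = q u w t om.
    apply: point_eq => i it; rewrite /ue /we !upd_lt//; exact: leq_trans it (leq_ord t).
  pose kappa := expR (- ((gw / 2) ^+ 2 / (8 * (r ^+ 2 / m%:R)))).
  apply: (@le_trans _ _ (\sum_(t < k.+1) 2 ^+ m * (4 * kappa))).
    apply: (@le_trans _ _ (\sum_(e : {ffun 'I_m -> bool}) \sum_(t < k.+1)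
      ((gw / 2 < `|dotp (signed e b) (lsubmx (q u w t om))|)%R%:R +
       (gw / 2 < `|dotp (signed e b') (rsubmx (q u w t om))|)%R%:R))).
      apply: ler_sum => e _.
      have S0 (t : 'I_k.+1) : 0 <= (gw / 2 < `|dotp (signed e b) (lsubmx (q u w t om))|)%R%:R +
       (gw / 2 < `|dotp (signed e b') (rsubmx (q u w t om))|)%R%:R :> R by rewrite addr_ge0.
      rewrite indicE; case: (boolP (om \in _)) => [|_]; last exact: sumr_ge0.
      rewrite inE => -[t]; rewrite /off qe /ue /we /upd eqxx => offt.
      rewrite (bigD1 t)//= -[leLHS]addr0 lerD//; last exact: sumr_ge0.
      by case/orP: offt => ->; rewrite ?lerDl ?lerDr.
    rewrite exchange_big/=; apply: ler_sum => t _; rewrite big_split/=.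
    have [Xq Yq] := point_feasible M gw c (A om) u w t.
    have rge0 : 0 <= r := radius_ge0 D0.
    rewrite /= !eball0E /= !enorm_le// in Xq Yq.
    apply: le_trans (lerD (signed_tail ob Xq) (signed_tail ob' Yq)) _.
    by rewrite -mulrDr -mulrDl -natrD.
  rewrite sumr_const card_ord -(mulr_natl (2 ^+ m * _)) mulrCA ler_wpM2l ?exprn_ge0//.
  have n0 : 0 < N.+1%:R :> R by rewrite ltr0n.
  have kN' : k.+1%:R <= N.+1%:R :> R by rewrite ler_nat.
  rewrite ler_pdivlMr ?mulr_gt0//; apply: le_trans tail; rewrite -/kappa.
  rewrite [leLHS](_ : _ = k.+1%:R * (16 * N.+1%:R * kappa)); last by ring.
  rewrite [leRHS](_ : _ = N.+1%:R * (16 * N.+1%:R * kappa)); last by ring.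
  by rewrite ler_wpM2r// !mulr_ge0// expR_ge0.
exists (signed e b), (signed e b'); split=> //.
- by apply: orthonormal_upd => //; [exact: signed_norm | move=> i; exact: sig].
- by apply: orthonormal_upd => //; [exact: signed_norm | move=> i; exact: sig].
Qed.

(** Outside the union of the bad events, of probability at most 1/4, the estimate
    [hard_gap_residual] holds seed by seed. One function serves both bounds. *)
Lemma randomized_instance : exists phi : 'rV[R]_(dimx dom + dimy dom) -> R,
  [/\ saddle_class p L D phi,
     ((3 / 4)%:E <= P [set om | (rate_constant p K * (L * D ^+ p / rate R p N) <=
        tan_residual (setx dom) (sety dom) phi (result (A om) phi))%R])%E &
     ((3 / 4)%:E <= P [set om | (rate_constant p K * (L * D ^+ p.+1 / rate R p N) <=
        gap (setx dom) (sety dom) phi (result (A om) phi))%R])%E].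
Proof.
have [u [w [ou ow H]]] := random_frames.
have g0 : 0 < gw := gapwidth_gt0 N D0.
pose phi := chain u w M gw c N.+1; exists phi.
pose B := \bigcup_(k in [set: 'I_N.+1]) bad u w k.
have mB : measurable B by apply: fin_bigcup_measurable => // k _.
have PB : (P B <= (1 / 4)%:E)%E.
  have := @union_event_le R _ Om P N.+1 (fun k => bad u w k) B (1 / (4 * N.+1%:R)) _ mB.
  rewrite (_ : N.+1%:R * _ = 1 / 4); last first.
    have : N.+1%:R != 0 :> R by rewrite pnatr_eq0.
    by move: (N.+1%:R) => t t0; field.
  apply=> [k|om [k _ Bk]|k] //; first by exists k.
  exact: H.
have PBc : ((3 / 4)%:E <= P (~` B))%E.
  rewrite probability_setC//; apply: (@le_trans _ _ (1%:E - (1 / 4)%:E)%E).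
    by rewrite -EFinB lee_fin; lra.
  exact: leeB.
have res om : (~` B) om -> result (A om) phi = q u w N om /\
    `|dotp (u N) (lsubmx (q u w N om))| <= gw / 2.
  move=> nB.
  have good t i : (t <= i <= N)%N -> `|dotp (u i) (lsubmx (q u w t om))| <= gw / 2 /\
      `|dotp (w i) (rsubmx (q u w t om))| <= gw / 2.
    move=> /andP[ti iN]; have iN' : (i < N.+1)%N by [].
    have ti' : (t < i.+1)%N by [].
    have : ~~ off (u i) (w i) (q u w t om).
      by apply/negP => oft; apply: nB; exists (Ordinal iN') => //; exists (Ordinal ti').
    by rewrite /off negb_or -!leNgt => /andP.
  split; first exact: result_chain.
  by have [|h _] := good N N; rewrite ?leqnn.
have bnd om (nB : (~` B) om) := hard_gap_residual p2 L0 D0 K0 ou ow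
  (point_feasible M gw c (A om) u w N) (proj2 (res om nB)).
have mres : coord_measurable (fun om => result (A om) phi).
  exact: (measurable_output_point mA (@cchain u w N.+1)).
have feas om : prodset (setx dom) (sety dom) (result (A om) phi) by exact: output_feasible.
have cphi : continuous phi by exact: (@cchain u w N.+1 [::]).
split.
- split.
  + have := diam_ball (d := dim) _ (radius_ge0 D0) (ltW D0) (radiusE D).
    by rewrite addn_gt0 m0 => ->.
  + exists setT; split => //; first exact: openT.
    exact: chain_smooth.
  + have [h1 h2] := @chain_convex_concave R dim u w M gw c N.+1 (coefficient_ge0 _ _ L0 D0 K0).
    by split=> [y _|x _] t a b _ _; [apply: h1 | apply: h2]; rewrite ?inE.
  + by move=> z z' _ _; apply: (hard_lip p2 L0 D0 K0 HK ou ow).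
- apply: le_trans PBc _; apply: le_measure; rewrite ?inE.
  + exact: measurableC.
  + apply: measurable_residual_event => //; try exact: eball_compact.
    by move=> i; exact: (@cchain u w N.+1 [:: delta_mx 0 i]).
  + by move=> om nB /=; have [-> _] := res om nB; have [] := bnd om nB.
- apply: le_trans PBc _; apply: le_measure; rewrite ?inE.
  + exact: measurableC.
  + by apply: measurable_gap_event => //; exact: eball_compact.
  + by move=> om nB /=; have [-> _] := res om nB; have [] := bnd om nB.
Qed.

End FixedDimension.

End Randomized.

(** * A dimension large enough for the tail bound *)

Section Dimension.
Context {R : realType} (N : nat) (D : R).
Hypothesis D0 : 0 < D.

Let T : R := N.+1%:R.
Let X : R := T ^+ 3 * ln N.+2%:R.

(** The tail exponent is m / (32 T levels^2) with [levels] <= 10 T; for it to reach 4 ln (N + 2), m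
    >= 12800 T^3 ln (N + 2) is enough, rounded up here to 20000. *)
Definition frame_dim : nat := (Num.truncn (2 * 10 ^+ 4 * X)).+1.

Let T1 : 1 <= T. Proof. by rewrite /T ler1n. Qed.

Let ln_ge : 2^-1 <= ln N.+2%:R :> R.
Proof.
have h : 2^-1 <= ln (2 : R).
  rewrite -[leLHS]expRK ler_ln ?posrE ?expR_gt0//.
  rewrite -[in leLHS](opprK 2^-1) expRN -[leRHS]invrK lef_pV2 ?posrE ?expR_gt0 ?invr_gt0//.
  by apply: le_trans (expR_ge1Dx _); lra.
by apply: le_trans h _; rewrite ler_ln ?posrE ?ltr0n// ler_nat.
Qed.

Let X_ge : T <= 2 * X.
Proof.
have T0 : 0 <= T := le_trans ler01 T1.
have T3 : T <= T ^+ 3.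
  by rewrite exprS ler_peMr// exprn_ege1.
have h : T ^+ 3 * 2^-1 <= X by rewrite ler_wpM2l// exprn_ge0.
by apply: le_trans T3 _; rewrite mulrC -ler_pdivrMr.
Qed.

Let X_ge0 : 0 <= 2 * 10 ^+ 4 * X.
Proof.
have ln0 : 0 <= ln N.+2%:R :> R by rewrite ln_ge0// ler1n.
have T0 : 0 <= T ^+ 3 by rewrite exprn_ge0// ler0n.
by apply: mulr_ge0; [rewrite mulr_ge0// exprn_ge0 | exact: mulr_ge0].
Qed.

Lemma frame_dim_le : (frame_dim + N)%:R <= 10 ^+ 5 * T ^+ 3 * ln N.+2%:R.
Proof.
have /andP[h _] := truncn_itv X_ge0.
rewrite /frame_dim addSn -addnS natrD -/T -[leRHS]mulrA -/X.
apply: le_trans (lerD h X_ge) _; rewrite -mulrDl ler_wpM2r//; last by lra.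
by have := X_ge0; rewrite pmulr_rge0// mulr_gt0// exprn_gt0.
Qed.

Lemma frame_dim_tail :
  16 * T ^+ 2 * expR (- ((gapwidth N D / 2) ^+ 2 / (8 * (radius D ^+ 2 / frame_dim%:R)))) <= 1.
Proof.
have T0 : 0 < T := lt_le_trans ltr01 T1.
have r0 := radius_gt0 D0; have l0 := @levels_gt0 R N.
have s0 : 0 < Num.sqrt T by rewrite sqrtr_gt0.
have m0 : 0 < frame_dim%:R :> R by rewrite ltr0n.
have mX : 2 * 10 ^+ 4 * X <= frame_dim%:R.
  by have /andP[_ h] := truncn_itv X_ge0; exact: ltW.
have E : (gapwidth N D / 2) ^+ 2 / (8 * (radius D ^+ 2 / frame_dim%:R)) =
    frame_dim%:R / (32 * T * levels N ^+ 2).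
  rewrite /gapwidth /amplitude -/T; move: r0 l0 m0.
  move: (radius D) (@levels R N) (frame_dim%:R : R) => a b c a0 b0 c0.
  rewrite !expr_div_n sqr_sqrtr ?(ltW T0)//.
  by field; rewrite !gt_eqF.
have lT : levels N <= 10 * T by rewrite /levels -/T; move: T T1 => t t1; lra.
have lT2 : levels N ^+ 2 <= 100 * T ^+ 2.
  rewrite (_ : 100 * T ^+ 2 = (10 * T) ^+ 2); last by ring.
  by rewrite ler_sqr ?nnegrE ?mulr_ge0// ltW.
have h : 4 * ln N.+2%:R <= frame_dim%:R / (32 * T * levels N ^+ 2).
  rewrite ler_pdivlMr ?mulr_gt0 ?exprn_gt0//; apply: le_trans mX.
  have ln0 : 0 <= ln N.+2%:R :> R by rewrite ln_ge0// ler1n.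
  rewrite [leLHS](_ : _ = 128 * ln N.+2%:R * T * levels N ^+ 2); last by ring.
  apply: (@le_trans _ _ (128 * ln N.+2%:R * T * (100 * T ^+ 2))).
    by apply: ler_wpM2l => //; rewrite !mulr_ge0// ltW.
  rewrite [leLHS](_ : _ = (128 * 100) * X); last by rewrite /X; ring.
  rewrite ler_wpM2r//; first by apply: mulr_ge0 => //; rewrite exprn_ge0// ltW.
  by lra.
rewrite E expRN ler_pdivrMr ?expR_gt0// mul1r.
apply: (@le_trans _ _ (expR (4 * ln N.+2%:R))); last by rewrite ler_expR.
rewrite mulrC mulr_natr -mulr_natl expRM_natl lnK ?posrE ?ltr0n//.
have -> : N.+2%:R = T + 1 by rewrite /T -natr1.
(* Squared, this gives 16 T^2 <= (N + 2)^4, which is why the exponent 4 ln (N + 2) was aimed at. *)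
have h1 : 4 * T <= (T + 1) ^+ 2 by have := sqr_ge0 (T - 1); rewrite sqrrB1 sqrrD1; move: T => t; lra.
rewrite (_ : 16 * T ^+ 2 = (4 * T) ^+ 2); last by ring.
rewrite (_ : (T + 1) ^+ 4 = ((T + 1) ^+ 2) ^+ 2); last by rewrite -exprM.
by rewrite ler_sqr ?nnegrE ?sqr_ge0// mulr_ge0// ltW.
Qed.

End Dimension.

Theorem theorem3p5 (R : realType) (p : nat) (hp : (2 <= p)%N) :
  exists a b C : R, [/\ 0 < a, 0 < b, 0 < C &
  forall (N : nat) (L D : R), (1 <= N)%N -> 0 < L -> 0 < D ->
  (forall A : (forall dom : domain R, policy p N dom),
     exists dom : domain R,
     [/\ dimx dom = (2 * N + 2)%N /\ dimy dom = (2 * N + 2)%N,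
         is_ball (setx dom),
         is_ball (sety dom),
         diam (setz dom) = D%:E &
         exists phi : 'rV[R]_(dimx dom + dimy dom) -> R,
         [/\ smooth phi,
             convex_concave setT setT phi,
             lip_D p L setT phi,
             a * (L * D ^+ p / rate R p N)
               <= tan_residual (setx dom) (sety dom) phi
                    (result (A dom) phi) &
             b * (L * D ^+ p.+1 / rate R p N)
               <= gap (setx dom) (sety dom) phi (result (A dom) phi)]])
  /\
  (forall (d : measure_display) (Om : measurableType d) (P : probability Om R)
          (A : forall dom : domain R, Om -> policy p N dom),
     (forall dom : domain R, measurable_policy (A dom)) ->
     exists dom : domain R,
     [/\ [/\ (0 < dimx dom)%N, (0 < dimy dom)%N,
             (dimx dom)%:R <= C * N.+1%:R ^+ 3 * ln N.+2%:R &
             (dimy dom)%:R <= C * N.+1%:R ^+ 3 * ln N.+2%:R],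
         is_ball (setx dom) /\ is_ball (sety dom),
         diam (setz dom) = D%:E,
         exists phi : 'rV[R]_(dimx dom + dimy dom) -> R,
           saddle_class p L D phi /\
           ((3 / 4)%:E <= P [set w | (a * (L * D ^+ p / rate R p N) <=
              tan_residual (setx dom) (sety dom) phi
                (result (A dom w) phi))%R])%E &
         exists phi : 'rV[R]_(dimx dom + dimy dom) -> R,
           saddle_class p L D phi /\
           ((3 / 4)%:E <= P [set w | (b * (L * D ^+ p.+1 / rate R p N) <=
              gap (setx dom) (sety dom) phi
                (result (A dom w) phi))%R])%E])].
Proof.
have [K K0 HK] := @coupling_lip R p hp.
have k0 := rate_constant_gt0 p K0.
(* One constant serves both bounds, since the residual bound is the gap bound divided by D; 10^5
   leaves room for the N extra dimensions. *)
exists (rate_constant p K), (rate_constant p K), (10 ^+ 5); split => //.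
move=> N L D _ L0 D0; split; first exact: deterministic_bound.
move=> d Om P A mA; have r0 := radius_ge0 D0.
pose dom := ball_domain (@frame_dim R N + N) (radius_ge0 D0); exists dom.
have m0 : (0 < @frame_dim R N)%N by [].
have isb : is_ball (setx dom) by exists 0, (radius D); split => //; exact: radius_gt0.
have [phi [cphi rphi gphi]] := randomized_instance hp L0 K0 HK m0
  (frame_dim_tail N D0) P (mA dom).
split.
- by split; rewrite ?frame_dim_le.
- by split.
- by apply: (diam_ball _ r0 (ltW D0) (radiusE D)).
- by exists phi.
- by exists phi.
Qed.
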